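(* Let $\Gamma=(V,E)$ be a finite graph, let $\{G_v\}_{v\in V}$ be a family of non-trivial finite abelian groups, and let $W=W(\Gamma,\{G_v\}_{v\in V})$ be their graph product. For $k\ge 1$ let $Z_k=\mathbb{Z}/2\ast\dots\ast\mathbb{Z}/2$ be the $k$-fold free product of groups of order two. Assume that there is no partition $V=V_1\sqcup\dots\sqcup V_\ell$ ($\ell\ge1$, all $V_i$ non-empty) such that the natural map $W_{\Gamma_{V_1}}\times\dots\times W_{\Gamma_{V_\ell}}\to W$ is an isomorphism and each $W_{\Gamma_{V_i}}$ is either isomorphic to $Z_k$ for some $k\ge1$ or finite abelian. Then $W$ admits infinitely many linearly independent homogeneous Aut-invariant quasimorphisms.
   Context: A finite graph $\Gamma=(V,E)$ consists of a non-empty finite vertex set $V$ and a set $E$ of 2-element subsets of $V$. For $X\subset V$, $\Gamma_X$ is the full subgraph spanned by $X$. Given non-trivial groups $\{G_v\}_{v\in V}$, the graph product is $W(\Gamma,\{G_v\}_{v\in V})=(\ast_{v\in V}G_v)/N$ where $N$ is the normal subgroup generated by all commutators $[G_x,G_y]$ with $\{x,y\}\in E$. For non-empty $X\subset V$, $W_{\Gamma_X}$ denotes the graph product on $\Gamma_X$ with vertex groups $\{G_v\}_{v\in X}$, viewed as the subgroup of $W$ generated by the $G_v$, $v\in X$. A quasimorphism on a group $G$ is a map $\psi\colon G\to\mathbb{R}$ with $\sup_{g,h}|\psi(g)+\psi(h)-\psi(gh)|<\infty$; homogeneous means $\psi(g^n)=n\psi(g)$ for all $g\in G$, $n\in\mathbb{Z}$;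 Aut-invariant means $\psi\circ\varphi=\psi$ for all automorphisms $\varphi$ of $G$. Linear independence is in the real vector space of functions $G\to\mathbb{R}$. *)

(* Defs.v *)
From HB Require Import structures.
From mathcomp Require Import all_boot all_order all_algebra all_fingroup.
From Stdlib Require Import Reals.
From mathcomp Require Import Rstruct.
Set Implicit Arguments. Unset Strict Implicit. Unset Printing Implicit Defensive.
Import GRing.Theory Num.Theory.

Local Open Scope group_scope.

Definition is_hom (A B : groupType) (f : A -> B) : Prop :=
  forall x y : A, f (x * y) = f x * f y.

Definition simple_graph (V : finType) (adj : rel V) : Prop :=
  symmetric adj /\ irreflexive adj.

(* W (with the maps iota_v : G_v -> W) is THE graph product
   W(Gamma,{G_v}) = ( *_v G_v ) / << [G_x,G_y], {x,y} in E >>,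
   characterised by its universal property (which determines it up to
   unique isomorphism compatible with the iota_v). *)
Definition is_graph_product (V : finType) (adj : rel V)
    (G : V -> groupType) (W : groupType) (iota : forall v, G v -> W) : Prop :=
  (forall v, is_hom (iota v)) /\
  (forall u v, adj u v -> forall (x : G u) (y : G v), commute (iota u x) (iota v y)) /\
  (forall (H : groupType) (f : forall v, G v -> H),
      (forall v, is_hom (f v)) ->
      (forall u v, adj u v -> forall (x : G u) (y : G v), commute (f u x) (f v y)) ->
      exists h : W -> H, is_hom h /\ (forall v (x : G v), h (iota v x) = f v x)
        /\ (forall h' : W -> H, is_hom h' -> (forall v (x : G v), h' (iota v x) = f v x) ->
              forall w, h' w = h w)).

Inductive gen (W : groupType) (A : W -> Prop) : W -> Prop :=
  | gen_base w : A w -> gen A w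
  | gen_one : gen A 1
  | gen_mul a b : gen A a -> gen A b -> gen A (a * b)
  | gen_inv a : gen A a -> gen A a^-1.

Definition sub_gp (V : finType) (G : V -> groupType) (W : groupType)
    (iota : forall v, G v -> W) (X : V -> bool) : W -> Prop :=
  gen (fun w => exists v (x : G v), X v /\ w = iota v x).

(* The subgroup S of W is isomorphic to Z_k = Z/2 * ... * Z/2 (k factors):
   S is generated by k elements t_j with t_j^2 = 1 and has the universal
   property of the free product of k groups of order two
   (i.e. of the presentation < t_1..t_k | t_j^2 >). *)
Definition iso_Zk (W : groupType) (S : W -> Prop) (k : nat) : Prop :=
  exists t : 'I_k -> W,
    (forall j, S (t j)) /\ (forall j, t j * t j = 1) /\
    (forall w, S w -> gen (fun a => exists j, a = t j) w) /\
    (forall (H : groupType) (h : 'I_k -> H), (forall j, h j * h j = 1) ->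
       exists f : W -> H, (forall a b, S a -> S b -> f (a * b) = f a * f b)
                          /\ (forall j, f (t j) = h j)).

Definition finite_abelian_sub (W : groupType) (S : W -> Prop) : Prop :=
  (exists (n : nat) (e : 'I_n -> W), forall w, S w -> exists i, e i = w) /\
  (forall a b, S a -> S b -> commute a b).

(* The partition V = V_0 |_| ... |_| V_{l-1} given by p : V -> 'I_l (all
   parts non-empty) is such that the natural map
   W_{V_0} x ... x W_{V_{l-1}} -> W, (w_i)_i |-> w_0 * ... * w_{l-1},
   is an isomorphism: it is a homomorphism (elements of distinct factors
   commute) and it is bijective. *)
Definition product_decomposition (V : finType) (G : V -> groupType)
    (W : groupType) (iota : forall v, G v -> W) (l : nat) (p : V -> 'I_l) : Prop :=
  let S i := sub_gp iota (fun v => p v == i) in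
  (forall i : 'I_l, exists v, p v = i) /\
  (forall i j : 'I_l, i != j -> forall a b, S i a -> S j b -> commute a b) /\
  (forall w : W, exists ws : 'I_l -> W, (forall i, S i (ws i)) /\ w = \prod_(i < l) ws i) /\
  (forall ws ws' : 'I_l -> W, (forall i, S i (ws i)) -> (forall i, S i (ws' i)) ->
      \prod_(i < l) ws i = \prod_(i < l) ws' i -> forall i, ws i = ws' i).

Local Open Scope ring_scope.

Definition quasimorphism (W : groupType) (psi : W -> Rdefinitions.R) : Prop :=
  exists D : Rdefinitions.R, forall g h : W, `|psi g + psi h - psi (g * h)%g| <= D.

Definition homogeneous (W : groupType) (psi : W -> Rdefinitions.R) : Prop :=
  forall (g : W) (n : nat),
    psi (g ^+ n)%g = n%:R * psi g /\ psi ((g ^+ n)^-1)%g = - (n%:R * psi g).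

Definition aut_invariant (W : groupType) (psi : W -> Rdefinitions.R) : Prop :=
  forall phi : W -> W, is_hom phi -> bijective phi -> forall g, psi (phi g) = psi g.

Definition lin_indep_family (W : groupType) (psi : nat -> W -> Rdefinitions.R) : Prop :=
  forall (n : nat) (c : 'I_n -> Rdefinitions.R),
    (forall g : W, \sum_(i < n) c i * psi i g = 0) -> forall i, c i = 0.

(* Main.v *)
Require Import Defs.
From HB Require Import structures.
From mathcomp Require Import all_boot all_order all_algebra all_fingroup.
From Stdlib Require Reals.
From mathcomp Require Import Rstruct.
From Stdlib Require Import ClassicalEpsilon.
From mathcomp Require Import zify lra.
Set Implicit Arguments. Unset Strict Implicit. Unset Printing Implicit Defensive.
Import Order.TTheory GRing.Theory Num.Theory.

(* Idea. If no triple (a, b, d) exists with a = b or a adjacent to b, with d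
   outside the stars of a and b, and with |G_a| > 2 when a = b, then
   non-adjacency is an equivalence relation, and its classes give an excluded
   product decomposition. Otherwise kill all vertices except a, b and d; this
   maps W onto A * B with A = G_a x G_b (or G_a) and B = G_d. An automorphism
   of W acting trivially on the finite abelianisation sends vertex groups to
   torsion, hence into conjugates of A or B, and surjectivity forces the
   induced map on A * B to be inner. So a homogeneous quasimorphism of A * B,
   pulled back to W, is invariant under a finite-index subgroup of Aut W, and
   summing over the finitely many remaining classes of automorphisms makes it
   Aut-invariant.

   To see that the sums are independent, count in the sequence of A-letters of
   a reduced word the places where a run of u equal letters is followed by a
   run of v equal letters, minus the same count for the inverse word. On
   (s y)^m (s' y)^n (s y)^k (s' y)^k with k < u < v the homogenised count is
   determined by comparing u, v with m, n, and any homomorphism to the free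
   product either preserves this value or, for u and v large, makes it 0:
   then some letter recurs in the image with bounded gaps. *)

Local Open Scope group_scope.
Local Notation RR := Rdefinitions.R.

(** * The free product of two copies of a finite group *)

Section FreeSquare.
Variable K : finGroupType.
Implicit Types (l m : bool * K) (u v w : seq (bool * K)) (i j : bool) (x y : K).

Definition reduced w :=
  all (fun l => l.2 != 1) w && sorted (fun l m => l.1 != m.1) w.

(** Left multiplication by one letter on normal forms. Words act on normal forms through it (van der
    Waerden's method), so associativity needs no analysis of cancellation in long words. *)
Definition push l w : seq (bool * K) :=
  if l.2 == 1 then w else
  if w is m :: w' then
    if m.1 == l.1 then
      if l.2 * m.2 == 1 then w' else (l.1, l.2 * m.2) :: w'
    else l :: w
  else [:: l].

Definition actw u w : seq (bool * K) := foldr push w u.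
Definition invw u : seq (bool * K) := rev [seq (l.1, l.2^-1) | l <- u].

Lemma reduced_cons l w :
  reduced (l :: w) = [&& l.2 != 1, reduced w & if w is m :: _ then l.1 != m.1 else true].
Proof.
rewrite /reduced /=; case: w => [|m w] /=; first by rewrite andbT.
by case: (l.2 != 1); case: (m.2 != 1); case: (l.1 != m.1); rewrite ?andbT ?andbF.
Qed.

Lemma reduced_behead l w : reduced (l :: w) -> reduced w.
Proof. by rewrite reduced_cons => /and3P[]. Qed.

Lemma reduced_push l w : reduced w -> reduced (push l w).
Proof.
rewrite /push; case: l => i x /=.
case: eqP => // /eqP nx; case: w => [|[j y] w] rw; first by rewrite reduced_cons nx.
move: (rw); rewrite reduced_cons /= => /and3P[ny rw' hw].
case: eqP => [eij|/eqP nij]; last by rewrite reduced_cons /= nx rw eq_sym.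
by case: eqP => // /eqP nxy; rewrite reduced_cons /= nxy rw' -eij.
Qed.

Lemma reduced_actw u w : reduced w -> reduced (actw u w).
Proof. by move=> rw; elim: u => //= l u IH; apply: reduced_push. Qed.

(** The delicate case is [y] cancelling the head letter: the next letter lies in the other factor
    since the word is reduced, so [x] finds nothing to merge with. *)
Lemma push_push i x y w :
  reduced w -> push (i, x) (push (i, y) w) = push (i, x * y) w.
Proof.
move=> rw; rewrite /push /=.
have [->|nx] := eqVneq x 1; first by rewrite mul1g.
have [->|ny] := eqVneq y 1; first by rewrite mulg1 (negPf nx).
case: w rw => [|[j z] w] /=; first by rewrite eqxx.
rewrite reduced_cons /= => /and3P[nz rw hw].
have [ej|nj] := eqVneq j i; last by rewrite /= eqxx.
have [yz|nyz] := eqVneq (y * z) 1.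
  have -> : (x * y == 1) = (x == z).
    by rewrite -(inj_eq (mulIg z)) -mulgA yz mulg1 mul1g.
  rewrite -mulgA yz mulg1 (negPf nx).
  case: w hw rw => [|[k t] w] /= hw rw.
    by have [->|//] := eqVneq x z; rewrite -ej.
  rewrite -ej eq_sym (negPf hw).
  by have [->|] := eqVneq x z.
rewrite /= eqxx.
have [xy|nxy] := eqVneq (x * y) 1.
  by rewrite mulgA xy mul1g (negPf nz) ej.
by rewrite mulgA.
Qed.

Lemma push1 i w : push (i, 1) w = w.
Proof. by rewrite /push /= eqxx. Qed.

Lemma actw_push l u w :
  reduced u -> reduced w -> actw (push l u) w = push l (actw u w).
Proof.
case: l => i x ru rw; rewrite {1}/push /=.
have [->|nx] := eqVneq x 1; first by rewrite push1.
case: u ru => [|[j y] u] ru //=.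
have [->|//] := eqVneq j i; rewrite push_push ?reduced_actw //.
by have [->|nxy] := eqVneq (x * y) 1; rewrite ?push1.
Qed.

Lemma actw_assoc u v w : reduced v -> reduced w ->
  actw (actw u v) w = actw u (actw v w).
Proof.
move=> rv rw; elim: u => //= l u IH.
by rewrite actw_push ?reduced_actw // IH.
Qed.

Lemma actw_cat u v : reduced (u ++ v) -> actw u v = u ++ v.
Proof.
elim: u => //= l u IH rl; rewrite IH; last exact: reduced_behead rl.
move: rl; rewrite reduced_cons /push => /and3P[/negPf-> _].
by case: (u ++ v) => // m w /negPf; rewrite eq_sym => ->.
Qed.

Lemma actw_nil u : reduced u -> actw u [::] = u.
Proof. by move=> ru; rewrite actw_cat cats0. Qed.

Lemma invwK : involutive invw.
Proof.
move=> u; rewrite /invw map_rev revK -map_comp -[RHS]map_id.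
by apply: eq_map => -[i x] /=; rewrite invgK.
Qed.

Lemma invw_cat u v : invw (u ++ v) = invw v ++ invw u.
Proof. by rewrite /invw map_cat rev_cat. Qed.

Lemma invw_cons l u : invw (l :: u) = rcons (invw u) (l.1, l.2^-1).
Proof. by rewrite /invw /= rev_cons. Qed.

Lemma size_invw u : size (invw u) = size u.
Proof. by rewrite size_rev size_map. Qed.

Lemma reduced_cat u v : reduced (u ++ v) =
  [&& reduced u, reduced v & if (u, v) is (l :: u', m :: _) then (last l u').1 != m.1 else true].
Proof.
rewrite /reduced all_cat; case: u => [|l u] /=; first by rewrite andbT.
rewrite cat_path; case: v => [|m v] /=; first by rewrite !andbT.
move: (l.2 != 1) (all _ u) (path _ l u) (m.2 != 1) (all _ v) (path _ m v).
by move: ((last l u).1 != m.1) => [] [] [] [] [] [] [].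
Qed.

Lemma reduced_invw u : reduced u -> reduced (invw u).
Proof.
case/andP => au su; apply/andP; split.
  by rewrite all_rev all_map; apply: sub_all au => l /=; rewrite eq_invg1.
rewrite rev_sorted sorted_map; apply: sub_sorted su => l m /=.
by rewrite eq_sym.
Qed.

Lemma actw_invl u : reduced u -> actw (invw u) u = [::].
Proof.
elim: u => // l u IH rl; rewrite invw_cons /actw foldr_rcons.
rewrite (_ : push _ _ = u); first exact: IH (reduced_behead rl).
move: rl; rewrite reduced_cons /push /= eq_invg1 => /andP[/negPf-> _].
by rewrite eqxx mulVg eqxx.
Qed.

Record fsq := Fsq { fsq_val :> seq (bool * K); _ : reduced fsq_val }.
HB.instance Definition _ := [isSub for fsq_val].
HB.instance Definition _ := [Choice of fsq by <:].

Definition fsq_mul (g h : fsq) : fsq := Fsq (reduced_actw g (valP h)).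
Definition fsq_one : fsq := Fsq (isT : reduced [::]).
Definition fsq_inv (g : fsq) : fsq := Fsq (reduced_invw (valP g)).

Lemma fsq_mulA : associative fsq_mul.
Proof. by move=> g h k; apply/val_inj; rewrite /= actw_assoc ?(valP h) ?(valP k). Qed.
Lemma fsq_mul1 : left_id fsq_one fsq_mul.
Proof. by move=> g; apply/val_inj. Qed.
Lemma fsq_mulr1 : right_id fsq_one fsq_mul.
Proof. by move=> g; apply/val_inj; rewrite /= actw_nil ?(valP g). Qed.
Lemma fsq_mulV : left_inverse fsq_one fsq_inv fsq_mul.
Proof. by move=> g; apply/val_inj; rewrite /= actw_invl ?(valP g). Qed.
Lemma fsq_mulVr : right_inverse fsq_one fsq_inv fsq_mul.
Proof.
move=> g; apply/val_inj; rewrite /= -{1}[fsq_val g]invwK actw_invl //.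
exact: reduced_invw (valP g).
Qed.

HB.instance Definition _ :=
  isGroup.Build fsq fsq_mulA fsq_mul1 fsq_mulr1 fsq_mulV fsq_mulVr.

End FreeSquare.

Section Hom.
Variables (A B : groupType) (f : A -> B).
Hypothesis hf : is_hom f.
Lemma is_hom1 : f 1 = 1.
Proof. by apply: (mulgI (f 1)); rewrite -hf !mulg1. Qed.
Lemma is_homV x : f x^-1 = (f x)^-1.
Proof. by apply: (mulgI (f x)); rewrite -hf !mulgV is_hom1. Qed.
Lemma is_homX x n : f (x ^+ n) = f x ^+ n.
Proof. by elim: n => [|n IH]; rewrite ?expg0 ?is_hom1 // !expgS hf IH. Qed.
End Hom.

Lemma conj_expg (A : groupType) (c g : A) n : (c * g * c^-1) ^+ n = c * g ^+ n * c^-1.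
Proof.
elim: n => [|n IH]; first by rewrite !expg0 mulg1 mulgV.
by rewrite !expgS IH !mulgA mulgKV.
Qed.

(** * Normal forms, torsion and endomorphisms of the free product *)

Section FreeSquareTheory.
Variable K : finGroupType.
Implicit Types (l m : bool * K) (u v w : seq (bool * K)) (i j : bool) (x y : K).
Implicit Types g h c : fsq K.

Lemma fsq_inj : injective (@fsq_val K). Proof. exact: val_inj. Qed.
Lemma fsq_valM g h : fsq_val (g * h) = actw g h. Proof. by []. Qed.
Lemma fsq_valV g : fsq_val g^-1 = invw g. Proof. by []. Qed.
Lemma fsq_val1 : fsq_val (1 : fsq K) = [::]. Proof. by []. Qed.
Lemma fsq_reduced g : reduced g. Proof. exact: valP g. Qed.

Lemma fsqM_cat g h : reduced (g ++ h) -> fsq_val (g * h) = g ++ h.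
Proof. exact: actw_cat. Qed.

Definition lett i x : fsq K := Fsq (reduced_push (i, x) (isT : reduced [::])).

Lemma lett_valE i x : fsq_val (lett i x) = if x == 1 then [::] else [:: (i, x)].
Proof. by []. Qed.

Lemma lettM i : is_hom (lett i).
Proof.
move=> x y; apply: fsq_inj; rewrite [RHS](@actw_push _ (i, x) [::]) ?reduced_push //.
by rewrite [RHS]push_push.
Qed.

Lemma lettM_val i x g : fsq_val (lett i x * g) = push (i, x) g.
Proof. exact: (@actw_push _ (i, x) [::] g isT (fsq_reduced g)). Qed.

Lemma lett1 i : lett i 1 = 1. Proof. exact: is_hom1 (lettM i). Qed.
Lemma lettV i x : lett i x^-1 = (lett i x)^-1. Proof. exact: is_homV (lettM i) x. Qed.

Lemma fsq_cons l w (rw : reduced (l :: w)) :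
  Fsq rw = lett l.1 l.2 * Fsq (reduced_behead rw).
Proof.
apply: fsq_inj; rewrite /= -/(push l [::]); case: l rw => i x rw.
have -> : push (i, x) [::] = [:: (i, x)].
  by move: (rw); rewrite reduced_cons /push /= => /andP[/negPf->].
by rewrite actw_cat.
Qed.

Lemma fsq_ind (P : fsq K -> Prop) :
  P 1 -> (forall i x g, x != 1 -> (if fsq_val g is m :: _ then i != m.1 else true) ->
            P g -> P (lett i x * g)) -> forall g, P g.
Proof.
move=> P1 Pl [w rw]; elim: w rw => [|l w IH] rw.
  by rewrite (_ : Fsq rw = 1) //; apply: fsq_inj.
have : reduced (l :: w) by [].
by rewrite fsq_cons reduced_cons => /and3P[nl _ hl]; apply: Pl.
Qed.

Section Extension.
Variables (H : groupType) (f : bool -> K -> H).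
Hypothesis fM : forall i, is_hom (f i).

Definition extw w := foldr (fun l a => f l.1 l.2 * a) 1 w.
Definition fsq_ext (g : fsq K) : H := extw g.

Lemma extw_push l w : extw (push l w) = f l.1 l.2 * extw w.
Proof.
case: l => i x; rewrite /push /=.
case: eqP => [->|_]; first by rewrite (is_hom1 (fM i)) mul1g.
case: w => [|[j y] w] //=.
case: eqP => [->|//]; rewrite mulgA -fM.
by case: eqP => [->|//]; rewrite (is_hom1 (fM i)) mul1g.
Qed.

Lemma fsq_extM : is_hom fsq_ext.
Proof.
move=> g h; rewrite /fsq_ext fsq_valM /actw.
elim: (fsq_val g) => [|l u IH] /=; first by rewrite mul1g.
by rewrite extw_push IH mulgA.
Qed.

Lemma fsq_ext_lett i x : fsq_ext (lett i x) = f i x.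
Proof. by rewrite /fsq_ext /= extw_push /= mulg1. Qed.
End Extension.

(* Any concatenation of words satisfying [block i] is again reduced. *)
Definition block i w :=
  reduced w && (if w is l :: w' then (l.1 == i) && ((last l w').1 != i) else false).

Lemma reduced_flatten i bs : all (block i) bs ->
  reduced (flatten bs) && (if flatten bs is m :: _ then m.1 == i else true).
Proof.
elim: bs => //= b bs IH /andP[/andP[rb hb] /IH/andP[rf hf]].
case: b rb hb => // l b rb /andP[/eqP hl hb] /=.
rewrite -cat_cons reduced_cat rb rf hl eqxx andbT /=.
by case: (flatten bs) hf => // m w /eqP->.
Qed.

Definition mprod (gs : seq (fsq K)) : fsq K := foldr (fun g h => g * h) 1 gs.

Lemma mprod_val i (gs : seq (fsq K)) : all (fun g => block i g) gs ->
  fsq_val (mprod gs) = flatten [seq fsq_val g | g <- gs].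
Proof.
elim: gs => // g gs IH bgs; have [bg bgs'] := andP bgs.
rewrite [mprod _]/= map_cons [RHS]/= fsqM_cat IH //.
have := @reduced_flatten i [seq fsq_val g | g <- g :: gs].
by rewrite all_map => /(_ bgs) /andP[].
Qed.

Lemma mprod_cat gs hs : mprod (gs ++ hs) = mprod gs * mprod hs.
Proof. by elim: gs => [|g gs IH] /=; rewrite ?mul1g // IH mulgA. Qed.

Lemma mprod_nseq n g : mprod (nseq n g) = g ^+ n.
Proof. by elim: n => //= n IH; rewrite IH expgS. Qed.

Lemma block_expg i g n : block i g -> fsq_val (g ^+ n) = flatten (nseq n (fsq_val g)).
Proof.
move=> bg; rewrite -mprod_nseq (@mprod_val i) ?map_nseq //.
by rewrite all_nseq bg orbT.
Qed.

Lemma size_flatten_nseq (T : Type) n (w : seq T) : size (flatten (nseq n w)) = (n * size w)%N.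
Proof. by elim: n => //= n IH; rewrite size_cat IH mulSn. Qed.

(** Induction on length: when the first and last letters share a factor, conjugation by the first
    merges the two and shortens the word. A word starting and ending in different factors is a
    block. *)
Lemma cyclic_reduction g : exists c h, g = c * h * c^-1 /\
  ((exists i x, h = lett i x) \/ exists i, block i h).
Proof.
move: {2}(size g) (leqnn (size g)) => n; elim: n g => [|n IH] g.
  rewrite leqn0 => /nilP g0; exists 1, 1; split; first by rewrite invg1 !mulg1; apply: fsq_inj.
  by left; exists true, 1; rewrite lett1.
move=> sg; have rg := fsq_reduced g.
case eg: (fsq_val g) => [|l w].
  by apply: IH; rewrite eg.
case/lastP: w eg => [|w m] eg.
  exists 1, g; split; first by rewrite invg1 mulg1 mul1g.
  left; exists l.1, l.2; apply: fsq_inj; rewrite /= eg.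
  by move: rg; rewrite eg reduced_cons => /andP[/negPf nl _]; rewrite /push nl; case: (l).
have [elm|nlm] := eqVneq l.1 m.1; last first.
  exists 1, g; split; first by rewrite invg1 mulg1 mul1g.
  by right; exists l.1; rewrite /block rg eg eqxx /= last_rcons eq_sym.
have rw : reduced w.
  by move: rg; rewrite eg -cats1 -cat_cons reduced_cat => /andP[/reduced_behead].
have eg' : g = lett l.1 l.2 * (Fsq rw * lett m.1 m.2).
  have rlw : reduced (l :: rcons w m) by rewrite -eg.
  have nm : m.2 != 1.
    by move: rlw; rewrite -rcons_cons -cats1 reduced_cat => /and3P[_ /andP[/andP[]]].
  apply: fsq_inj; rewrite lettM_val fsq_valM lett_valE (negPf nm) -!surjective_pairing.
  rewrite actw_cat ?cats1; last exact: reduced_behead rlw.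
  by rewrite -[push l _]/(actw [:: l] _) eg actw_cat.
have [|c [h [ec hh]]] := IH (Fsq rw * lett l.1 (m.2 * l.2)).
  have szp p v : (size (push p v) <= (size v).+1)%N.
    rewrite /push; case: ifP => //; case: v => //= q v _; case: ifP => //= _.
    by case: ifP => //=; lia.
  have sza u v : (size (actw u v) <= size u + size v)%N.
    elim: u => //= p u IHu; apply: leq_trans (szp _ _) _; lia.
  apply: leq_trans (sza _ _) _.
  move: sg; rewrite eg /= size_rcons => sg.
  have := szp (l.1, m.2 * l.2) [::]; rewrite /=; lia.
exists (lett l.1 l.2 * c), h; split=> //.
have -> : lett l.1 l.2 * c * h * (lett l.1 l.2 * c)^-1
  = lett l.1 l.2 * (c * h * c^-1) * (lett l.1 l.2)^-1 by rewrite invgM !mulgA.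
by rewrite -ec lettM elm eg' -elm !mulgA mulgK.
Qed.

(** Powers of a block grow in length, so torsion leaves only the one-letter case of
    [cyclic_reduction]. *)
Lemma torsion_lett g n : (0 < n)%N -> g ^+ n = 1 -> exists c i x, g = c * lett i x * c^-1.
Proof.
move=> n0 gn; have [c [h [eg [[i [x ex]]|[i bi]]]]] := cyclic_reduction g.
  by exists c, i, x; rewrite -ex.
have : h ^+ n = 1.
  by move: gn; rewrite eg conj_expg => /(canRL (mulgKV c)) /(canRL (mulKg c)); rewrite mul1g mulVg.
move/(congr1 (@fsq_val K))/(congr1 size); rewrite (block_expg n bi) size_flatten_nseq.
by case: n n0 {gn} => // n _; move: bi; rewrite /block; case: (fsq_val h); rewrite // andbF.
Qed.

(* The word [w] absorbs no letter of index [i] on the left and none of index [j] on the right. *)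
Definition ends i j w := if w is l :: w' then (l.1 != i) && ((last l w').1 != j) else true.

(** Applied to conjugators: the outer letters are later absorbed by the abelian factors, and only
    the core [c] matters. *)
Lemma double_coset i j g : exists x y c, g = lett i x * c * lett j y /\ ends i j c.
Proof.
have [x [h [-> hh]]] :
    exists x h, g = lett i x * h /\ (if fsq_val h is m :: _ then m.1 != i else true).
  elim/fsq_ind: g => [|k x g nx hg _]; first by exists 1, 1; rewrite lett1 mulg1.
  have [<-|nk] := eqVneq k i.
    by exists x, g; split=> //; case: (fsq_val g) hg => // m _; rewrite eq_sym.
  exists 1, (lett k x * g); rewrite lett1 mul1g; split=> //.
  rewrite lettM_val /push (negPf nx); case: (fsq_val g) hg => // m w hm.
  by rewrite eq_sym (negPf hm).
case eh: (fsq_val h) hh => [|l w] hh.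
  exists x, 1, h; rewrite lett1 mulg1; split=> //.
  by rewrite /ends eh.
have rh := fsq_reduced h; rewrite eh in rh.
have [lj|nlj] := eqVneq (last l w).1 j; last first.
  by exists x, 1, h; rewrite lett1 mulg1; split=> //; rewrite /ends eh hh.
case/lastP: w eh rh lj => [|w m] eh rh lj.
  exists x, l.2, 1; rewrite mulg1; split=> //; congr (_ * _).
  apply: fsq_inj; rewrite /= eh /push -lj.
  by move: rh; rewrite reduced_cons /= => /andP[/negPf-> _]; case: (l).
have [rlw /andP[nm _] hlm] : [/\ reduced (l :: w), reduced [:: m] & (last l w).1 != m.1].
  by apply/and3P; move: rh; rewrite -cats1 -cat_cons reduced_cat.
rewrite last_rcons in lj.
exists x, m.2, (Fsq rlw); split; last by rewrite /ends /= hh -lj.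
rewrite -mulgA; congr (_ * _); apply: fsq_inj; rewrite eh fsq_valM lett_valE.
have /negPf-> : m.2 != 1 by case/andP: nm.
by rewrite -lj -surjective_pairing actw_cat /= cats1.
Qed.

Hypothesis commK : forall x y : K, commute x y.

Lemma lettC i x y : commute (lett i x) (lett i y).
Proof. by rewrite /commute -!lettM commK. Qed.

Lemma ends_invw i j w : ends i j w -> ends j i (invw w).
Proof.
case: w => // l w; rewrite invw_cons /ends /= => /andP[hl].
case/lastP: w => [|w m] /=; first by rewrite andbC hl.
by rewrite !last_rcons /invw map_rcons rev_rcons /= last_rcons hl andbT.
Qed.

Lemma ends_reduced_cat i j k u v : reduced u -> reduced v -> ends i j u -> ends (~~ j) k v ->
  reduced (u ++ v).
Proof.
move=> ru rv; rewrite reduced_cat ru rv /=.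
case: u v {ru rv} => [|l u] [|m v] //= /andP[_]; case: (_.1) => + /andP[+ _];
by case: j; case: (_.1).
Qed.

(** It suffices to treat the double coset core [c] of [g]. Were it non-trivial, [lett i x * c] and
    [c * lett i x] would both be reduced as written, one starting in the factor [i] and the other
    not. *)
Lemma lett_centraliser i x g :
  x != 1 -> commute (lett i x) g -> exists y, g = lett i y.
Proof.
move=> nx; have [y [z [c [-> ec]]]] := double_coset i i g.
rewrite /commute => cg.
have cc : lett i x * c = c * lett i x.
  apply: (mulgI (lett i y)); apply: (mulIg (lett i z)).
  rewrite -!mulgA (lettC i x z) !mulgA (lettC i y x) -!mulgA.
  by rewrite !mulgA in cg *.
suff c1 : c = 1 by exists (y * z); rewrite c1 mulg1 lettM.
have rx : reduced [:: (i, x)] by rewrite reduced_cons nx.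
have vx : fsq_val (lett i x) = [:: (i, x)] by rewrite lett_valE (negPf nx).
apply: fsq_inj; rewrite fsq_val1.
have := congr1 (@fsq_val K) cc; rewrite !fsqM_cat vx.
- by case: (fsq_val c) ec => //= l w /andP[+ _] [el]; rewrite -el eqxx.
- apply: (@ends_reduced_cat i i (~~ i)) ec _ => //; first exact: fsq_reduced.
  by rewrite /ends /=; case: (i).
- apply: (@ends_reduced_cat (~~ i) (~~ i) i) => //; first exact: fsq_reduced.
  by rewrite /ends /=; case: (i).
  by rewrite negbK.
Qed.

Section Spread.
Variable c : fsq K.
Hypothesis ec : ends false true c.
Hypothesis cN1 : fsq_val c <> [::].

(** Normal form of a map that conjugates each free factor separately: the factor [false] is fixed
    and the factor [true] is conjugated by [c]. *)
Definition spread_lett i x := if i then c * lett true x * c^-1 else lett false x.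

Lemma spread_lettM i : is_hom (spread_lett i).
Proof.
rewrite /spread_lett; case: i => x y; last exact: lettM.
by rewrite lettM !mulgA mulgKV.
Qed.

Definition spread := fsq_ext spread_lett.

Lemma spreadM : is_hom spread. Proof. exact: fsq_extM spread_lettM. Qed.

Lemma spread_lettE i x : spread (lett i x) = spread_lett i x.
Proof. exact: (fsq_ext_lett spread_lettM). Qed.

Definition sprw l := if l.1 then c ++ l :: invw c else [:: l].

Lemma sprw_ends l : l.2 != 1 ->
  [/\ fsq_val (spread_lett l.1 l.2) = sprw l, ends (~~ l.1) (~~ l.1) (sprw l) & sprw l != [::]].
Proof.
case: l => -[] x nx; last by split=> //; have := lett_valE false x; rewrite (negPf nx).
have rx : reduced [:: (true, x)] by rewrite reduced_cons nx.
have vx : fsq_val (lett true x) = [:: (true, x)] by rewrite lett_valE (negPf nx).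
have ec' := ends_invw ec.
have rcx : reduced (c ++ [:: (true, x)]).
  by apply: (ends_reduced_cat _ _ ec (_ : ends _ false _)); rewrite ?fsq_reduced.
have vcx : fsq_val (c * lett true x) = c ++ [:: (true, x)] by rewrite fsqM_cat vx.
have ecx : ends false false (c ++ [:: (true, x)]).
  by case: (fsq_val c) ec => //= l w /andP[-> _]; rewrite /= last_cat.
split.
- rewrite [LHS](@fsqM_cat (c * lett true x)) vcx fsq_valV -?catA // catA.
  apply: (ends_reduced_cat _ _ ecx ec'); rewrite ?reduced_invw ?fsq_reduced //.
- rewrite /sprw /=; case: (fsq_val c) ec ec' cN1 => // l w.
  rewrite /= => /andP[-> _] + _; rewrite last_cat /=.
  by case/lastP: (invw _) => // v m; rewrite last_rcons; case: v => [|? ?] /= /andP[_]; rewrite ?last_rcons.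
- by rewrite /sprw /=; case: (fsq_val c).
Qed.

(** The ends of [c] keep the images of successive letters from cancelling, so lengths in the image
    can be read off letter by letter. *)
Lemma spread_val g : fsq_val (spread g) = flatten [seq sprw l | l <- fsq_val g].
Proof.
rewrite /spread /fsq_ext; have := fsq_reduced g.
elim: (fsq_val g) => // l w IH rlw; rewrite map_cons [flatten _]/= -IH; last exact: reduced_behead rlw.
have rw := reduced_behead rlw.
have [vl el nl] : [/\ fsq_val (spread_lett l.1 l.2) = sprw l,
    ends (~~ l.1) (~~ l.1) (sprw l) & sprw l != [::]].
  by apply: sprw_ends; move: rlw; rewrite reduced_cons => /andP[].
rewrite [extw _ _]/= fsqM_cat vl //.
case: w rlw rw IH => [|m w] rlw rw IH; first by rewrite cats0 -vl fsq_reduced.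
have [vm em nm] : [/\ fsq_val (spread_lett m.1 m.2) = sprw m,
    ends (~~ m.1) (~~ m.1) (sprw m) & sprw m != [::]].
  by apply: sprw_ends; move: rw; rewrite reduced_cons => /andP[].
have elm : l.1 != m.1 by move: rlw; rewrite reduced_cons => /and3P[].
rewrite reduced_cat -{1}vl !fsq_reduced IH // map_cons [flatten _]/=.
case: (sprw l) el nl => // p u /= /andP[_ hp] _.
case: (sprw m) em nm => // q v /= /andP[hq _] _.
by move: (last p u).1 q.1 hp hq elm => [] []; case: (l.1); case: (m.1).
Qed.
End Spread.

(* Unless [c] is trivial, [spread c] gives every element of infinite order translation length at
   least 4, whereas a product of two letters has translation length 2. *)
Lemma spread_not_conj c x y g e : ends false true c -> x != 1 -> y != 1 ->
  spread c g = e * (lett false x * lett true y) * e^-1 -> fsq_val c = [::].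
Proof.
move=> ec nx ny eg; case ec0: (fsq_val c) => [//|l0 w0]; exfalso.
have cN1 : fsq_val c <> [::] by rewrite ec0.
set ab := lett false x * lett true y in eg.
have vab : fsq_val ab = [:: (false, x); (true, y)].
  by rewrite /ab lettM_val lett_valE (negPf ny) /push /= (negPf nx).
have bab : block false ab by rewrite /block fsq_reduced vab.
have [f [h [egf hh]]] := cyclic_reduction g.
have sM := spreadM c.
have eh : spread c h = ((spread c f)^-1 * e) * ab * ((spread c f)^-1 * e)^-1.
  move: eg; rewrite egf !sM (is_homV sM) => eg.
  rewrite invgM invgK.
  transitivity ((spread c f)^-1 * (spread c f * spread c h * (spread c f)^-1) * spread c f).
    by rewrite !mulgA mulVg mul1g mulgKV.
  by rewrite eg !mulgA.
move: {eg}(_ * e) eh => d eh.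
have sizeM (a b : fsq K) : (size (fsq_val (a * b)%g) <= size a + size b)%N.
  rewrite fsq_valM; elim: (fsq_val a) => //= p u IHu.
  apply: (@leq_trans (size (actw u b)).+1); last by rewrite addSn ltnS.
  rewrite /push; case: ifP => //; case: (actw u b) => //= q v _; case: ifP => //= _.
  by case: ifP => //=; lia.
have ehn n : spread c (h ^+ n) = d * ab ^+ n * d^-1 by rewrite (is_homX sM) eh conj_expg.
case: hh => [[i [z ez]]|[i bh]].
  (* A single letter has finite order, whereas the powers of [ab] grow in length. *)
  have := ehn #[z]; rewrite ez -(is_homX (lettM i)) expg_order lett1 (is_hom1 sM).
  move/(congr1 (fun t => d^-1 * t * d)); rewrite mulg1 mulVg !mulgA mulVg mul1g mulgKV.
  move/(congr1 (@fsq_val K))/(congr1 size); rewrite (block_expg _ bab) size_flatten_nseq vab.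
  by have := order_gt0 z; case: #[z] => // n; rewrite muln2.
(* A block has letters of both factors, and a letter of the factor [true] has an image of length at
   least 3. *)
have le_h : (4 <= size (flatten [seq sprw c l | l <- fsq_val h]))%N.
  have szc : (0 < size (fsq_val c))%N by rewrite ec0.
  move: bh; rewrite /block; case: (fsq_val h) => [|p [|q u]]; rewrite ?andbF //=.
    by case/and3P=> _ /eqP->; rewrite eqxx.
  case/andP => /andP[_ /= /andP[+ _]] _; rewrite !size_cat /sprw.
  by case: p.1; case: q.1 => // _; rewrite size_cat /= size_invw; lia.
(* For [n] one more than the length of [d], the left side has length at least [4 * n] and the right
   side at most [2 * n + 2 * (n - 1)]. *)
have := ehn (size (fsq_val d)).+1.
move/(congr1 (@fsq_val K))/(congr1 size); rewrite (spread_val ec cN1) (block_expg _ bh).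
have -> n (w : seq (bool * K)) : flatten [seq sprw c l | l <- flatten (nseq n w)]
   = flatten (nseq n (flatten [seq sprw c l | l <- w])).
  by elim: n => //= n IH; rewrite map_cat flatten_cat IH.
rewrite size_flatten_nseq => esz.
have := sizeM (d * ab ^+ (size d).+1) d^-1; have := sizeM d (ab ^+ (size d).+1).
rewrite -esz (block_expg _ bab) size_flatten_nseq vab fsq_valV size_invw /=.
have := leq_mul (leqnn (size d).+1) le_h; lia.
Qed.
End FreeSquareTheory.

(** * Counting runs of letters *)

Section Counting.
Variable T : eqType.
Implicit Types (s t r : seq T) (x y : T) (a b c d n p : nat).

Definition starts_other x s := if s is y :: _ then y != x else true.

Section Pattern.
Variables u v : nat.
Hypotheses (u0 : (0 < u)%N) (v0 : (0 < v)%N).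

(** The default [x] of [nth] makes the test fail on words of length at most [u]. *)
Definition pat s :=
  if s is x :: _ then
    let y := nth x s u in (x != y) && (take (u + v) s == nseq u x ++ nseq v y)
  else false.

Fixpoint cnt s := if s is x :: s' then (pat s + cnt s')%N else 0%N.

Lemma patP s : reflect (exists x y s', x != y /\ s = nseq u x ++ nseq v y ++ s') (pat s).
Proof.
apply: (iffP idP).
  case: s => // x s /andP[nxy /eqP e].
  by exists x, (nth x (x :: s) u), (drop (u + v) (x :: s)); rewrite catA -e cat_take_drop.
move=> [x [y [s' [nxy ->]]]]; rewrite /pat.
have [r er] : exists r, nseq u x ++ nseq v y ++ s' = x :: r.
  by rewrite -(prednK u0) /=; eexists.
rewrite er /= -er nth_cat size_nseq ltnn subnn.
have -> : nth x (nseq v y ++ s') 0 = y by rewrite -(prednK v0).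
by rewrite nxy catA take_size_cat ?size_cat ?size_nseq //= eqxx.
Qed.

Arguments pat : simpl never.

Lemma pat_cat s t : pat s -> pat (s ++ t).
Proof.
by case/patP=> x [y [s' [nxy ->]]]; apply/patP; exists x, y, (s' ++ t); rewrite -!catA.
Qed.

Lemma pat_catl s t : (u + v <= size s)%N -> pat (s ++ t) -> pat s.
Proof.
move=> us /patP[x [y [s' [nxy e]]]]; apply/patP; exists x, y, (drop (u + v) s); split=> //.
rewrite -{1}(cat_take_drop (u + v) s) catA; congr (_ ++ _).
rewrite -(takel_cat t us) e catA take_size_cat //.
by rewrite size_cat !size_nseq.
Qed.

Lemma cnt_cat_ge s t : (cnt s + cnt t <= cnt (s ++ t))%N.
Proof.
elim: s => //= x s IH.
have : (pat (x :: s) <= pat (x :: s ++ t))%N.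
  by case e: (pat _) => //; rewrite -cat_cons pat_cat.
lia.
Qed.

(** New occurrences straddle the junction, so they start among the last [u + v] letters of [s]. The
    bound with [minn] is the form that passes through the induction. *)
Lemma cnt_cat_le s t : (cnt (s ++ t) <= cnt s + cnt t + (u + v))%N.
Proof.
suff : (cnt (s ++ t) <= cnt s + cnt t + minn (size s) (u + v))%N by lia.
elim: s => [|x s IH] /=; first lia.
have [le|gt] := leqP (u + v) (size (x :: s)).
  have : (pat (x :: s ++ t) <= pat (x :: s))%N.
    by case e: (pat _) => //; rewrite -cat_cons in e; rewrite (pat_catl le e).
  by move: le => /=; lia.
by move: gt => /=; case: (pat (x :: s ++ t)) => /=; lia.
Qed.

Lemma cnt_le_size s : (cnt s <= size s)%N.
Proof. by elim: s => //= x s IH; case: (pat _) => /=; lia. Qed.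

Lemma cnt_short x d t : (d < u)%N -> starts_other x t -> cnt (nseq d x ++ t) = cnt t.
Proof.
move=> du ht; elim: d du => //= d IH du; rewrite IH ?(ltnW du) //.
case: patP => // -[x' [y [s' [nxy e]]]]; exfalso.
have ex : x' = x by move: e; rewrite -(prednK u0) /= => -[].
have := congr1 (fun l => nth y l d.+1) e; rewrite /= !nth_cat !size_nseq ltnn subnn du nth_nseq du ex.
case: t ht {IH e} => [_|z t /= nz zx]; last by rewrite zx eqxx in nz.
by move=> /= yx; rewrite ex yx eqxx in nxy.
Qed.

Lemma cnt_nseq x a : cnt (nseq a x) = 0%N.
Proof.
elim: a => //= a ->; case: patP => // -[x' [y [s' [nxy e]]]].
have : x' \in x :: nseq a x by rewrite e mem_cat mem_nseq u0 eqxx.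
have : y \in x :: nseq a x by rewrite e !mem_cat !mem_nseq v0 eqxx /= orbT.
rewrite -[x :: _]/(nseq a.+1 x) !mem_nseq /= => /eqP yx /eqP xx.
by rewrite yx xx eqxx in nxy.
Qed.

(** Of the starts inside the run of [x], only the one with exactly [u] letters of the run left puts
    the change of letter in the right place. *)
Lemma cnt_step x y a b t : x != y -> (0 < b)%N -> starts_other y t ->
  cnt (nseq a x ++ nseq b y ++ t) = (cnt (nseq b y ++ t) + ((u <= a) && (v <= b)))%N.
Proof.
move=> nxy b0 ht; elim: a => [|a IH]; first by rewrite leqn0 (gtn_eqF u0) addn0.
have bE : b = b.-1.+1 by rewrite prednK.
rewrite [LHS]/= IH.
suff -> : pat (x :: nseq a x ++ nseq b y ++ t) = (a.+1 == u) && (v <= b)%N.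
  by case: (v <= b)%N; rewrite ?andbF ?andbT //=; lia.
apply/patP/idP => [[x' [y' [s' [nxy' e]]]]|/andP[/eqP eu vb]]; last first.
  exists x, y, (nseq (b - v) y ++ t); split=> //.
  by rewrite -eu (catA (nseq v y)) -nseqD subnKC.
have ex : x' = x by move: e; rewrite -(prednK u0) /= => -[].
subst x'.
have e' : nseq a.+1 x ++ nseq b y ++ t = nseq u x ++ nseq v y' ++ s' by [].
have [ltu|gtu|eu] := ltngtP a.+1 u.
- have := congr1 (fun l => nth y l a.+1) e'.
  rewrite !nth_cat !size_nseq ltnn subnn b0 ltu !nth_nseq b0 ltu => /eqP.
  by rewrite eq_sym (negPf nxy).
- have := congr1 (fun l => nth y l u) e'.
  rewrite !nth_cat !size_nseq ltnn subnn v0 gtu !nth_nseq gtu v0 => /eqP.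
  by rewrite (negPf nxy').
move: e'; rewrite eu => /eqP; rewrite eqseq_cat ?size_nseq // => /andP[_ /eqP e'].
have ey : y' = y by move: e'; rewrite bE -(prednK v0) /= => -[].
rewrite /=; case: leqP => // bv; move: e'; rewrite ey.
move/(congr1 (fun l => nth x l b)); rewrite !nth_cat !size_nseq ltnn subnn bv nth_nseq bv.
case: t ht {IH e} => [_ /= xy|z t /= nz zy]; last by rewrite zy eqxx in nz.
by rewrite xy eqxx in nxy.
Qed.

(** Runs of length [c] are too short for either half of the pattern, so in each period only the
    junction from the [a]-run to the [b]-run can count. *)
Lemma cnt_test x y a b c n :
  x != y -> (0 < a)%N -> (0 < b)%N -> (0 < c)%N -> (c < u)%N -> (c < v)%N ->
  cnt (flatten (nseq n (nseq a x ++ nseq b y ++ nseq c x ++ nseq c y))) =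
  (n * ((u <= a) && (v <= b)))%N.
Proof.
move=> nxy a0 b0 c0 cu cv; have nyx : y != x by rewrite eq_sym.
elim: n => //= n IH; rewrite -!catA; move: IH; set t := flatten _ => IH.
have tx : t = [::] \/ exists t', t = x :: t'.
  rewrite /t; case: (n) => [|n'] /=; first by left.
  by right; rewrite -(prednK a0) /=; eexists.
have ot : starts_other y t by case: tx => [->|[t' ->]].
have ns d z s : (0 < d)%N -> z \in [:: x; y] -> starts_other (if z == x then y else x) (nseq d z ++ s).
  by case: d => // d _; rewrite !inE => /orP[]/eqP->; rewrite ?eqxx ?(negPf nyx).
have sx s : starts_other y (nseq c x ++ s) by case: (c) c0.
have sy s : starts_other x (nseq c y ++ s) by case: (c) c0.
rewrite cnt_step // cnt_step //.
by rewrite cnt_short // cnt_short // IH mulSn (leqNgt v c) cv andbF addn0 addnC.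
Qed.

(** The periods are those of [cnt_test] read backwards, as in an inverse word; now only the junction
    from the [b]-run to the [a]-run can count. *)
Lemma cnt_test_rev x y a b c n :
  x != y -> (0 < a)%N -> (0 < b)%N -> (0 < c)%N -> (c < u)%N -> (c < v)%N ->
  cnt (flatten (nseq n (nseq c y ++ nseq c x ++ nseq b y ++ nseq a x))) =
  (n * ((u <= b) && (v <= a)))%N.
Proof.
move=> nxy a0 b0 c0 cu cv; have nyx : y != x by rewrite eq_sym.
elim: n => //= n IH; rewrite -!catA; move: IH; set t := flatten _ => IH.
have ot : starts_other x t by rewrite /t; case: (n) => // n' /=; case: (c) c0.
have sx s : starts_other y (nseq c x ++ s) by case: (c) c0.
have sy s : starts_other x (nseq b y ++ s) by case: (b) b0.
rewrite cnt_short // cnt_short // cnt_step //.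
suff -> : cnt (nseq a x ++ t) = cnt t by rewrite IH mulSn addnC.
rewrite /t; case: (n) => [|n'] /=; first by rewrite cats0 cnt_nseq.
by rewrite -!catA cnt_step // (leqNgt v c) cv andbF addn0.
Qed.

Definition recurrent p x s := forall s1 t s2, s = s1 ++ t ++ s2 -> (p <= size t)%N -> x \in t.

(** Both runs of an occurrence would be long enough to contain [x], hence would be runs of the same
    letter. *)
Lemma cnt_recurrent p x s : (p <= u)%N -> (p <= v)%N -> recurrent p x s -> cnt s = 0%N.
Proof.
move=> pu pv; elim: s => //= y s IH D.
rewrite IH ?addn0; last by move=> s1 t s2 e; apply: (D (y :: s1) t s2); rewrite e.
case: patP => // -[x' [y' [s' [nxy e]]]].
have := D [::] (nseq u x') (nseq v y' ++ s') e; rewrite size_nseq mem_nseq => /(_ pu)/andP[_ /eqP ex].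
have := D (nseq u x') (nseq v y') s' e; rewrite size_nseq mem_nseq => /(_ pv)/andP[_ /eqP ey].
by rewrite -ex -ey eqxx in nxy.
Qed.
End Pattern.

Lemma recurrent_rev p x s (f : T -> T) : involutive f ->
  recurrent p x s -> recurrent p (f x) (rev (map f s)).
Proof.
move=> fK D s1 t s2 e pt.
have es : s = map f (rev s2) ++ map f (rev t) ++ map f (rev s1).
  rewrite -!map_cat -!rev_cat -catA -e revK -map_comp -[LHS]map_id.
  by apply: eq_map => z /=; rewrite fK.
have := D _ _ _ es; rewrite size_map size_rev => /(_ pt)/mapP[z].
by rewrite mem_rev => zt ->; rewrite fK.
Qed.

(** Among any [p] consecutive positions one is congruent to [i] modulo [p]. *)
Lemma recurrent_flatten p i x (bs : seq (seq T)) : (i < p)%N ->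
  (forall b : seq T, b \in bs -> size b = p /\ nth x b i = x) -> recurrent p x (flatten bs).
Proof.
move=> ip hb s1 t s2 e pt.
have hn j : (j < size (flatten bs))%N -> j = i %[mod p] -> nth x (flatten bs) j = x.
  elim: bs hb j {e} => // b bs IH hb j /=.
  have [sb nb] : size b = p /\ nth x b i = x by apply: hb; rewrite inE eqxx.
  rewrite size_cat sb nth_cat sb => jlt jm; case: ltnP => jp.
    by move: jm; rewrite !modn_small // => ->.
  apply: IH; [by move=> b' ib'; apply: hb; rewrite inE ib' orbT| lia|].
  by rewrite -jm -{2}(subnK jp) modnDr.
have p0 : (0 < p)%N by lia.
pose k := ((i + (p - size s1 %% p)) %% p)%N.
have kp : (k < p)%N by rewrite ltn_mod.
have := hn (size s1 + k)%N; rewrite e !size_cat nth_cat.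
have -> : (size s1 + k < size s1)%N = false by lia.
rewrite addKn nth_cat (leq_trans kp pt) => <-; first by apply: mem_nth; apply: leq_trans kp pt.
- by lia.
rewrite /k modnDmr {1}(divn_eq (size s1) p).
have := ltn_pmod (size s1) p0 => sm.
have -> : (size s1 %/ p * p + size s1 %% p + (i + (p - size s1 %% p)) = (size s1 %/ p).+1 * p + i)%N by lia.
by rewrite modnMDl.
Qed.
End Counting.

(** * Counting in the letters of one free factor *)

Section FactorLetters.
Variable K : finGroupType.
Implicit Types (g h c : fsq K) (w e : seq (bool * K)).

Definition letters0 w : seq K := [seq l.2 | l <- w & ~~ l.1].

Lemma letters0_cat w1 w2 : letters0 (w1 ++ w2) = letters0 w1 ++ letters0 w2.
Proof. by rewrite /letters0 filter_cat map_cat. Qed.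

Lemma letters0_flatten ws : letters0 (flatten ws) = flatten (map letters0 ws).
Proof. by elim: ws => //= w ws IH; rewrite letters0_cat IH. Qed.

Lemma letters0_invw w : letters0 (invw w) = rev (map invg (letters0 w)).
Proof.
rewrite /letters0 /invw filter_rev map_rev filter_map -!map_comp.
by congr rev; rewrite -[RHS]map_comp.
Qed.

(** Cancellation removes [v] against its inverse and stops when two letters merge into one or the
    facing letters lie in different factors; a merge involves one letter from each side. *)
Lemma fsq_junction g h : exists u e1 v e2 w e,
  [/\ fsq_val g = u ++ e1 ++ v, fsq_val h = invw v ++ e2 ++ w, fsq_val (g * h) = u ++ e ++ w &
      [/\ size e1 <= 1, size e2 <= 1 & size e <= 1]%N].
Proof.
case: g => g rg; case: h => h rh; rewrite fsq_valM [fsq_val _]/= [fsq_val (Fsq rh)]/=.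
elim/last_ind: g rg h rh => [|g l IH] rg h rh.
  by exists [::], [::], [::], [::], h, [::].
case: h rh => [|m h] rh.
  by exists (rcons g l), [::], [::], [::], [::], [::]; rewrite actw_cat !cats0.
have [elm|nlm] := eqVneq m.1 l.1; last first.
  exists (rcons g l), [::], [::], [::], (m :: h), [::]; rewrite actw_cat ?cats0 //.
  rewrite reduced_cat rg rh; case/lastP: {IH} g rg => [|g p] _ /=; rewrite ?rcons_cons /= ?last_rcons.
    by rewrite eq_sym.
  by case: g => /= *; rewrite ?last_rcons eq_sym.
have rg' : reduced g by move: rg; rewrite -cats1 reduced_cat => /andP[].
have [lm1|nlm1] := eqVneq (l.2 * m.2) 1.
  have [u [e1 [v [e2 [w [e [eg eh egh se]]]]]]] := IH rg' h (reduced_behead rh).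
  exists u, e1, (rcons v l), e2, w, e; split=> //.
  - by rewrite eg -!cats1 -!catA.
  - rewrite eh /invw map_rcons rev_rcons /=; congr (_ :: _).
    by rewrite [LHS]surjective_pairing elm -[l.2^-1]mulg1 -lm1 mulKg.
  rewrite -egh /actw foldr_rcons {2}/push elm eqxx lm1 eqxx.
  case: eqP => // l1; move: rg; rewrite -cats1 reduced_cat => /and3P[_ /andP[/andP[nl _] _] _].
  by rewrite l1 eqxx in nl.
have nl : l.2 != 1 by move: rg; rewrite -cats1 reduced_cat => /and3P[_ /andP[/andP[]]].
exists g, [:: l], [::], [:: m], h, [:: (l.1, l.2 * m.2)]; split; rewrite ?cats1 //.
rewrite /actw foldr_rcons {2}/push (negPf nl) elm eqxx (negPf nlm1) /=.
rewrite -[foldr _ _ _]/(actw _ _) actw_cat // reduced_cat rg'.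
have -> : reduced ((l.1, l.2 * m.2) :: h).
  by move: rh; rewrite !reduced_cons /= nlm1 elm => /andP[_].
by move: rg; rewrite -cats1 reduced_cat => /and3P[_ _].
Qed.

(** After antisymmetrising, the contributions of [v] and [invw v] cancel and those of [u] and [w]
    reappear in the product. A bounded number of junctions and single letters remains; the constant
    is generous. *)
Lemma junction_quasi (F : seq (bool * K) -> nat) C g h :
  (forall s t, F s + F t <= F (s ++ t) <= F s + F t + C)%N -> (forall s, F s <= size s)%N ->
  (`|((F g)%:Z - (F (invw g))%:Z) + ((F h)%:Z - (F (invw h))%:Z)
     - ((F (g * h)%g)%:Z - (F (invw (g * h)%g))%:Z)| <= (100 * C + 100)%:Z)%R.
Proof.
move=> FD Fs.
have [u [e1 [v [e2 [w [e [-> -> -> [s1 s2 s3]]]]]]]] := fsq_junction g h.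
rewrite !invw_cat invwK.
have le1 t : (size t <= 1)%N -> (F t <= 1)%N by apply: leq_trans (Fs t).
have := le1 e1 s1; have := le1 e2 s2; have := le1 e s3.
have := le1 (invw e1); have := le1 (invw e2); have := le1 (invw e); rewrite !size_invw.
move=> /(_ s3) h1 /(_ s2) h2 /(_ s1) h3 h4 h5 h6.
have F3 s t r : (F s + F t + F r <= F (s ++ t ++ r) <= F s + F t + F r + 2 * C)%N.
  by have := FD s (t ++ r); have := FD t r; lia.
have F3' s t r : (F s + F t + F r <= F ((s ++ t) ++ r) <= F s + F t + F r + 2 * C)%N.
  by rewrite -catA.
have := F3 u e1 v; have := F3 (invw v) e2 w; have := F3 u e w.
have := F3' (invw v) (invw e1) (invw u); have := F3' (invw w) (invw e2) v.
have := F3' (invw w) (invw e) (invw u).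
lia.
Qed.

Section PatternCocycle.
Variables u v : nat.
Hypotheses (u0 : (0 < u)%N) (v0 : (0 < v)%N).
Local Notation N w := (cnt u v (letters0 w)).

(** A counting quasimorphism in the style of Brooks, antisymmetrised under inversion. *)
Definition code g : int := ((N g)%:Z - (N (invw g))%:Z)%R.

Lemma code_quasi g h : (`|code g + code h - code (g * h)%g| <= (100 * (u + v) + 100)%:Z)%R.
Proof.
apply: (@junction_quasi (fun w => N w)) => [s t|s].
  by rewrite letters0_cat (cnt_cat_ge u0 v0) (cnt_cat_le u0 v0).
apply: leq_trans (cnt_le_size u0 v0 _) _.
by rewrite /letters0 size_map size_filter count_size.
Qed.

Lemma code_recurrent g p x : (p <= u)%N -> (p <= v)%N -> recurrent p x (letters0 g) -> code g = 0%R.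
Proof.
move=> pu pv D; rewrite /code letters0_invw (cnt_recurrent u0 v0 pu pv D).
by rewrite (cnt_recurrent u0 v0 pu pv (recurrent_rev (@invgK _) D)).
Qed.
End PatternCocycle.
End FactorLetters.

(** * Homogeneous quasimorphisms *)

Section Homogenisation.
Local Open Scope ring_scope.

Lemma archimedean_le0 (x C : RR) : (forall n : nat, n%:R * x <= C) -> x <= 0.
Proof.
move=> h; rewrite leNgt; apply/negP => x0.
have C0 : 0 <= C by have := h 0%N; rewrite mul0r.
have := archi_boundP (divr_ge0 C0 (ltW x0)); rewrite ltr_pdivrMr // ltNge => /negP; apply.
exact: h.
Qed.

Lemma archimedean_eq (x y C : RR) :
  (forall n : nat, `|n%:R * x - n%:R * y| <= C) -> x = y.
Proof.
move=> h; apply/eqP; rewrite -subr_eq0 eq_le; apply/andP; split.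
  apply: (@archimedean_le0 _ C) => n; rewrite mulrBr.
  exact: le_trans (ler_norm _) (h n).
rewrite -oppr_le0; apply: (@archimedean_le0 _ C) => n; rewrite opprB mulrBr.
by apply: le_trans (ler_norm _) _; rewrite distrC.
Qed.

Variables (A : groupType) (f : A -> RR) (D : RR).
Hypothesis fD : forall g h : A, `|f g + f h - f (g * h)%g| <= D.

Lemma quasi_expg g n : `|n%:R * f g - f (g ^+ n)%g| <= (n%:R + 1) * D.
Proof.
elim: n => [|n IH].
  by have := fD 1%g 1%g; rewrite mulg1 expg0 mul0r !ler_norml => /andP[? ?]; lra.
have := fD g (g ^+ n)%g; rewrite -expgS mulrSr.
by move: IH; rewrite !ler_norml => /andP[? ?] /andP[? ?]; lra.
Qed.

(** The slope is the limit of [f (g ^+ n) / n]. Completeness yields it as the supremum of the lower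
    estimates [(f (g ^+ n) - 2 * D) / n], each of which is below every upper estimate
    [(f (g ^+ m) + 2 * D) / m]. *)
Lemma asymptotic_slope g : exists r : RR, forall n, `|f (g ^+ n)%g - n%:R * r| <= 2 * D.
Proof.
have D0 : 0 <= D by apply: le_trans (normr_ge0 _) (fD 1%g 1%g).
(* Both terms are compared with [f] at the power of [g] with exponent [m.+1 * n.+1]. *)
have cross m n : m.+1%:R * f (g ^+ n.+1)%g - n.+1%:R * f (g ^+ m.+1)%g
    <= 2 * D * (n.+1%:R + m.+1%:R).
  have := quasi_expg (g ^+ n.+1)%g m.+1; have := quasi_expg (g ^+ m.+1)%g n.+1.
  rewrite -!expgM mulnC !ler_norml => /andP[? ?] /andP[? ?].
  have : 0 <= D * (n.+1%:R - 1) by rewrite mulr_ge0 // subr_ge0 ler1n.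
  have : 0 <= D * (m.+1%:R - 1) by rewrite mulr_ge0 // subr_ge0 ler1n.
  by lra.
pose E (x : RR) := exists n, x = (f (g ^+ n.+1)%g - 2 * D) / n.+1%:R.
have up m : Raxioms.is_upper_bound E ((f (g ^+ m.+1)%g + 2 * D) / m.+1%:R).
  move=> x [n ->]; apply/RleP; rewrite ler_pdivrMr ?ltr0Sn // mulrAC ler_pdivlMr ?ltr0Sn //.
  by have := cross m n; lra.
have [r [ur lr]] : {r | Raxioms.is_lub E r}.
  apply: Raxioms.completeness; first by exists ((f (g ^+ 1)%g + 2 * D) / 1%:R); exact: up 0%N.
  by eexists; exists 0%N.
exists r => -[|n].
  by rewrite mul0r subr0 expg0; have := fD 1%g 1%g; rewrite mulg1 !ler_norml => /andP[? ?]; lra.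
have /RleP := ur _ (ex_intro _ n erefl); rewrite ler_pdivrMr ?ltr0Sn // => h1.
have /RleP := lr _ (up n); rewrite ler_pdivlMr ?ltr0Sn // => h2.
by rewrite ler_norml; lra.
Qed.

(** The last clause evaluates [psi] exactly wherever [f] is linear along powers. *)
Lemma homogenisation : exists psi : A -> RR,
  [/\ quasimorphism psi, homogeneous psi &
      forall g c, (forall n, f (g ^+ n)%g = n%:R * c) -> psi g = c].
Proof.
pose psi g := proj1_sig (constructive_indefinite_description _ (asymptotic_slope g)).
have psiP g n : `|f (g ^+ n)%g - n%:R * psi g| <= 2 * D.
  by rewrite /psi; case: constructive_indefinite_description.
have psiV g : psi g^-1%g = - psi g.
  apply: (@archimedean_eq _ _ (6 * D)) => n.
  have := psiP g n; have := psiP g^-1%g n; have := fD (g ^+ n)%g (g^-1 ^+ n)%g.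
  rewrite expVgn mulgV; have := fD 1%g 1%g; rewrite mulg1 !ler_norml.
  by move=> /andP[? ?] /andP[? ?] /andP[? ?] /andP[? ?]; lra.
have psiX g k : psi (g ^+ k)%g = k%:R * psi g.
  apply: (@archimedean_eq _ _ (4 * D)) => n.
  have := psiP g (k * n)%N; have := psiP (g ^+ k)%g n.
  by rewrite -expgM natrM !ler_norml => /andP[? ?] /andP[? ?]; lra.
exists psi; split.
- exists (7 * D) => g h.
  have := psiP g 1%N; have := psiP h 1%N; have := psiP (g * h)%g 1%N; have := fD g h.
  by rewrite !expg1 !mul1r !ler_norml => /andP[? ?] /andP[? ?] /andP[? ?] /andP[? ?]; lra.
- by move=> g n; rewrite psiV psiX.
- move=> g c hc; apply: (@archimedean_eq _ _ (2 * D)) => n.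
  by rewrite -hc distrC; exact: psiP.
Qed.
End Homogenisation.

Section HomogeneousQuasimorphism.
Variables (A : groupType) (psi : A -> RR).
Hypotheses (qpsi : quasimorphism psi) (hpsi : homogeneous psi).
Local Open Scope ring_scope.

Lemma homogeneousX g n : psi (g ^+ n)%g = n%:R * psi g.
Proof. by case: (hpsi g n). Qed.

Lemma homogeneousV g : psi g^-1%g = - psi g.
Proof. by have [_] := hpsi g 1; rewrite expg1 mul1r. Qed.

Lemma homogeneous1 : psi 1%g = 0.
Proof. by have := homogeneousX 1%g 0; rewrite mul0r expg0. Qed.

Lemma homogeneous_torsion g n : (0 < n)%N -> (g ^+ n)%g = 1%g -> psi g = 0.
Proof.
move=> n0 gn; have := homogeneousX g n; rewrite gn homogeneous1 => /esym/eqP.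
by rewrite mulf_eq0 pnatr_eq0 -leqn0 leqNgt n0 => /eqP.
Qed.

(** Conjugation changes the value at [g ^+ n] by an amount bounded independently of [n]; homogeneity
    divides it by [n]. *)
Lemma homogeneousJ c g : psi (c * g * c^-1)%g = psi g.
Proof.
have [D hD] := qpsi; apply: (@archimedean_eq _ _ (2 * D)) => n.
rewrite -!homogeneousX conj_expg.
have := hD c (g ^+ n * c^-1)%g; have := hD (g ^+ n)%g c^-1%g; rewrite homogeneousV mulgA.
by rewrite !ler_norml => /andP[? ?] /andP[? ?]; lra.
Qed.
End HomogeneousQuasimorphism.

(** * Values of the counting quasimorphisms on test words *)

Section Code.
Variable K : finGroupType.
Implicit Types (g S B Y : fsq K) (psi : fsq K -> RR) (u v a b c : nat).

Definition homog_code u v psi :=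
  [/\ quasimorphism psi, homogeneous psi &
      forall g (c : int), (forall n : nat, code u v (g ^+ n) = (n%:Z * c)%R) -> psi g = (c%:~R)%R].

Lemma homog_code_exists u v : (0 < u)%N -> (0 < v)%N -> exists psi, homog_code u v psi.
Proof.
move=> u0 v0.
have [|psi [qp hp cp]] := @homogenisation _ (fun g => ((code u v g)%:~R : RR)%R)
   (((100 * (u + v) + 100)%N%:Z)%:~R)%R.
  move=> g h; rewrite -intrD -intrB -intr_norm ler_int; exact: code_quasi.
exists psi; split=> // g c hc; apply: cp => n.
by rewrite hc intrM.
Qed.

(** The tail with exponents [c] breaks a symmetry: without it, periodicity would bring in the
    junction from the [b]-run back to the [a]-run, and the antisymmetrised count would vanish. *)
Definition twist S S' B a b c : fsq K :=
  (S * B) ^+ a * (S' * B) ^+ b * (S * B) ^+ c * (S' * B) ^+ c.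

Lemma twistJ e S S' B a b c :
  twist (e * S * e^-1) (e * S' * e^-1) (e * B * e^-1) a b c = e * twist S S' B a b c * e^-1.
Proof.
have eM x y : e * x * e^-1 * (e * y * e^-1) = e * (x * y) * e^-1 by rewrite !mulgA mulgKV.
by rewrite /twist !eM !conj_expg !eM.
Qed.

Definition pattern_value u v a b : RR :=
  (((u <= a) && (v <= b))%N%:R - ((u <= b) && (v <= a))%N%:R)%R.

Definition twist_seq (T : Type) (x y : T) a b c := nseq a x ++ nseq b y ++ nseq c x ++ nseq c y.

Lemma map_twist_seq (T1 T2 : Type) (f : T1 -> T2) x y a b c :
  map f (twist_seq x y a b c) = twist_seq (f x) (f y) a b c.
Proof. by rewrite /twist_seq !map_cat !map_nseq. Qed.

Lemma mem_twist_seq (T : eqType) (x y z : T) a b c n :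
  z \in flatten (nseq n (twist_seq x y a b c)) -> z = x \/ z = y.
Proof.
case/flattenP=> t; rewrite mem_nseq => /andP[_ /eqP->].
rewrite !mem_cat !mem_nseq => /or4P[]/andP[_ /eqP->]; by [left|right].
Qed.

Lemma twist_block i s Y : s != 1 -> fsq_val Y != [::] -> ends i i Y ->
  fsq_val (lett i s * Y) = (i, s) :: Y /\ block i (lett i s * Y).
Proof.
move=> ns nY eY.
have vY : fsq_val (lett i s * Y) = (i, s) :: Y.
  rewrite lettM_val /push (negPf ns); case: (fsq_val Y) eY nY => // l w /andP[+ _] _.
  by move/negPf->.
split=> //; rewrite /block fsq_reduced vY eqxx /=.
by case: (fsq_val Y) eY nY => // l w /andP[_].
Qed.

Section TwistLetters.
Variables (i : bool) (s s' : K) (Y : fsq K).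
Hypotheses (ns : s != 1) (ns' : s' != 1) (nY : fsq_val Y != [::]) (eY : ends i i Y).

(** As [Y] begins and ends outside the factor [i], its products with the two letters are blocks, and
    nothing cancels in any power. *)
Lemma letters0_twist a b c n :
  letters0 (twist (lett i s) (lett i s') Y a b c ^+ n) =
  flatten (flatten (nseq n (twist_seq (letters0 ((i, s) :: Y)) (letters0 ((i, s') :: Y)) a b c))).
Proof.
have [v b0] := twist_block ns nY eY; have [v' b0'] := twist_block ns' nY eY.
have -> : twist (lett i s) (lett i s') Y a b c ^+ n =
  mprod (flatten (nseq n (twist_seq (lett i s * Y) (lett i s' * Y) a b c))).
  elim: n => //= n IH; rewrite expgS IH mprod_cat; congr (_ * _).
  by rewrite /twist_seq !mprod_cat !mprod_nseq !mulgA.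
rewrite (@mprod_val _ i); last first.
  by apply/allP => g /mem_twist_seq[]->.
rewrite letters0_flatten -map_comp map_flatten map_nseq map_twist_seq /comp.
by rewrite v v'.
Qed.
End TwistLetters.

Section Evaluation.
Variables (u v : nat) (psi : fsq K -> RR).
Hypotheses (u0 : (0 < u)%N) (v0 : (0 < v)%N) (hc : homog_code u v psi).

Lemma homog_code_recurrent g p (x : K) : (p <= u)%N -> (p <= v)%N ->
  (forall n, recurrent p x (letters0 (g ^+ n))) -> psi g = 0%R.
Proof.
move=> pu pv D; have [_ _ /(_ g 0%R) ->] := hc; rewrite ?mulr0z // => n.
by rewrite mulr0 (code_recurrent u0 v0 pu pv (D n)).
Qed.

(** Here [Y] adds no counted letter, so the counted letters of the powers are exactly periodic and
    [code] is linear along them. *)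
Lemma homog_code_twist s s' Y a b c :
  s != 1 -> s' != 1 -> s != s' -> (0 < a)%N -> (0 < b)%N -> (0 < c)%N -> (c < u)%N -> (c < v)%N ->
  fsq_val Y != [::] -> ends false false Y -> letters0 Y = [::] ->
  psi (twist (lett false s) (lett false s') Y a b c) = pattern_value u v a b.
Proof.
move=> ns ns' nss a0 b0 c0 cu cv nY eY lY.
have [_ _ /(_ _ (((u <= a) && (v <= b))%N%:Z - ((u <= b) && (v <= a))%N%:Z)%R) ->] := hc.
  by rewrite intrB.
have ls t : letters0 ((false, t) :: Y) = [:: t] by rewrite [LHS](_ : _ = t :: letters0 Y) // lY.
move=> n; rewrite /code letters0_invw letters0_twist // !ls.
have -> x y : flatten (flatten (nseq n (twist_seq [:: x] [:: y] a b c)))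
    = flatten (nseq n (twist_seq x y a b c)) :> seq K.
  by rewrite -[RHS]map_id -(flatten_map1 id) map_flatten map_nseq map_twist_seq.
have -> : rev (map invg (flatten (nseq n (twist_seq s s' a b c)))) =
    flatten (nseq n (nseq c s'^-1 ++ nseq c s^-1 ++ nseq b s'^-1 ++ nseq a s^-1)).
  by rewrite map_flatten map_nseq rev_flatten map_nseq rev_nseq map_twist_seq /twist_seq
             !rev_cat !rev_nseq -!catA.
rewrite cnt_test // cnt_test_rev ?(inj_eq invg_inj) //.
by rewrite !PoszM mulrBr.
Qed.
End Evaluation.

(** Powers of a block repeat one list of counted letters, so its first entry recurs with a gap
    independent of the power. A conjugate of a single letter is torsion. *)
Lemma homog_code_eventually0 g : exists J, forall u v psi, (J < u)%N -> (J < v)%N ->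
  homog_code u v psi -> psi g = 0%R.
Proof.
have [c [h [-> [[i [x ->]]|[i bh]]]]] := cyclic_reduction g.
  exists 0%N => u v psi u0 v0 [qp hp _]; rewrite homogeneousJ //.
  apply: (homogeneous_torsion hp (order_gt0 x)).
  by rewrite -(is_homX (lettM i)) expg_order lett1.
exists (size (letters0 h)) => u v psi hu hv hc; have [qp hp _] := hc; rewrite homogeneousJ //.
case eh: (letters0 h) hu hv => [|x s] hu hv.
  (* With no counted letters there is no window of length 1, and recurrence is vacuous. *)
  apply: (@homog_code_recurrent u v psi _ _ hc h 1 1) => // n.
  rewrite (block_expg n bh) letters0_flatten map_nseq eh => s1 t s2.
  have -> : flatten (nseq n [::]) = [::] :> seq K by elim: (n).
  by case: s1 => // /esym; case: t.
apply: (@homog_code_recurrent u v psi _ _ hc h (size s).+1 x); rewrite ?(ltnW hu) ?(ltnW hv) //.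
- exact: leq_ltn_trans hu.
- exact: leq_ltn_trans hv.
move=> n; rewrite (block_expg n bh) letters0_flatten map_nseq eh.
apply: (@recurrent_flatten _ _ 0) => // b; rewrite mem_nseq => /andP[_ /eqP->].
by [].
Qed.

(** A counted letter of [Y] stands at a fixed place in every block, so it recurs and forces the
    value 0. The bound [size Y] makes [u] and [v] at least the number of counted letters of a
    block. *)
Lemma twist_eventually i s s' Y : s != 1 -> s' != 1 -> s != s' ->
  fsq_val Y != [::] -> ends i i Y ->
  exists J, forall u v psi a b c, (J < u)%N -> (J < v)%N -> homog_code u v psi ->
    (0 < a)%N -> (0 < b)%N -> (0 < c)%N -> (c < u)%N -> (c < v)%N ->
    psi (twist (lett i s) (lett i s') Y a b c) = 0%R \/
    psi (twist (lett i s) (lett i s') Y a b c) = pattern_value u v a b.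
Proof.
move=> ns ns' nss nY eY; exists (size Y) => u v psi a b c hu hv hc a0 b0 c0 cu cv.
have u0 : (0 < u)%N by apply: leq_ltn_trans hu.
have v0 : (0 < v)%N by apply: leq_ltn_trans hv.
have szY : (size (letters0 Y) <= size Y)%N by rewrite /letters0 size_map size_filter count_size.
have rec p j x : (j < p)%N -> (p <= (size Y).+1)%N ->
    (forall t, size (letters0 ((i, t) :: Y)) = p /\ nth x (letters0 ((i, t) :: Y)) j = x) ->
    psi (twist (lett i s) (lett i s') Y a b c) = 0%R.
  move=> jp pY hx; apply: (homog_code_recurrent u0 v0 hc (p := p) (x := x)).
  - exact: leq_trans hu.
  - exact: leq_trans hv.
  move=> n; rewrite letters0_twist //; apply: (@recurrent_flatten _ p j) => // w.
  by case/mem_twist_seq=> ->.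
case: i eY rec => eY rec.
  left; case eY0: (letters0 Y) => [|x w].
    (* For [i = true] the word [Y] starts in the factor [false], so it has a counted letter. *)
    exfalso; move: eY nY eY0; rewrite /letters0; case: (fsq_val Y) => // l y.
    by rewrite /= => /andP[+ _]; case: l.1.
  by apply: (@rec (size w).+1 0 x) => // [|t]; [rewrite eY0 in szY; apply: leqW|rewrite /letters0 /= -/(letters0 _) eY0].
case eY0: (letters0 Y) => [|x w].
  by right; apply: homog_code_twist.
left; apply: (@rec (size w).+2 1%N x) => // [|t]; first by rewrite eY0 in szY.
by rewrite /letters0 /= -/(letters0 _) eY0.
Qed.
End Code.

(** * Torsion in the free product *)

Lemma expg_dvdn1 (A : groupType) (x : A) E n : x ^+ E = 1 -> (E %| n)%N -> x ^+ n = 1.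
Proof. by move=> xE /dvdnP[k ->]; rewrite mulnC expgM xE expg1n. Qed.

Section Torsion.
Variable K : finGroupType.
Hypothesis commK : forall x y : K, commute x y.
Implicit Types (g S B Y : fsq K) (psi : fsq K -> RR) (i j : bool) (x y : K).

Lemma conj_lett_val (c : fsq K) i j y : y != 1 -> ends i j c -> (fsq_val c == [::] -> j != i) ->
  fsq_val (c * lett j y * c^-1) != [::] /\ ends i i (c * lett j y * c^-1).
Proof.
move=> ny ec hc.
have ry : reduced [:: (j, y)] by rewrite reduced_cons ny.
have vy : fsq_val (lett j y) = [:: (j, y)] by rewrite lett_valE (negPf ny).
have [c0|cN] := boolP (fsq_val c == [::]).
  have -> : c = 1 by apply: fsq_inj; rewrite (eqP c0).
  by rewrite invg1 mulg1 mul1g vy /= hc.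
have ec' := ends_invw ec; have rc := fsq_reduced c.
have rcy : reduced (c ++ [:: (j, y)]).
  apply: (@ends_reduced_cat _ i j (~~ j) _ _ rc ry ec) => //=.
  by case: (j).
have vcy : fsq_val (c * lett j y) = c ++ [:: (j, y)] by rewrite fsqM_cat vy.
have ecy : ends i (~~ j) (c ++ [:: (j, y)]).
  case: (fsq_val c) ec cN => //= l w /andP[-> _] _.
  by rewrite last_cat /=; case: (j).
have r : reduced ((c ++ [:: (j, y)]) ++ invw c).
  apply: (ends_reduced_cat rcy (reduced_invw rc) ecy (_ : ends _ i _)).
  by rewrite negbK.
rewrite fsqM_cat vcy fsq_valV //; split; first by case: (fsq_val c) cN.
case: (fsq_val c) ec ec' cN => // l w /= /andP[-> _] + _.
rewrite last_cat; case/lastP: (invw _) (size_invw (l :: w)) => // v m _.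
by rewrite last_rcons; case: v => [|? ?] /= /andP[_]; rewrite ?last_rcons.
Qed.

(** Only torsion and one commutation are assumed, since these survive in the image under any
    homomorphism. Unless the situation degenerates, conjugation turns [S], [S'], [B] into two
    letters of one factor and a word [Y] as in [twist_eventually]. *)
Lemma twist_dichotomy S S' B E : (0 < E)%N -> S ^+ E = 1 -> S' ^+ E = 1 -> B ^+ E = 1 ->
  commute S S' ->
  exists J, forall u v psi a b c, (J < u)%N -> (J < v)%N -> homog_code u v psi ->
    (E %| a)%N -> (E %| b)%N -> (E %| c)%N ->
    (0 < a)%N -> (0 < b)%N -> (0 < c)%N -> (c < u)%N -> (c < v)%N ->
    psi (twist S S' B a b c) = 0%R \/ psi (twist S S' B a b c) = pattern_value u v a b.
Proof.
move=> E0 SE S'E BE cSS'.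
(* In the degenerate cases the test words with exponents divisible by [E] are all powers of one
   element [h], where [psi] vanishes once [u] and [v] are large. *)
have power h : (forall a b c, (E %| a)%N -> (E %| b)%N -> (E %| c)%N ->
     exists n, twist S S' B a b c = h ^+ n) ->
  exists J, forall u v psi a b c, (J < u)%N -> (J < v)%N -> homog_code u v psi ->
    (E %| a)%N -> (E %| b)%N -> (E %| c)%N ->
    (0 < a)%N -> (0 < b)%N -> (0 < c)%N -> (c < u)%N -> (c < v)%N ->
    psi (twist S S' B a b c) = 0%R \/ psi (twist S S' B a b c) = pattern_value u v a b.
  move=> hp; have [J hJ] := homog_code_eventually0 h.
  exists J => u v psi a b c Ju Jv hc Ea Eb Ec *; left.
  have [n ->] := hp a b c Ea Eb Ec; have [_ hpsi _] := hc.
  by rewrite (homogeneousX hpsi) (hJ _ _ _ Ju Jv hc) mulr0.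
have [S1|nS] := eqVneq S 1.
  apply: (power (S' * B)) => a b c Ea Eb Ec; exists (b + c)%N.
  by rewrite /twist S1 !mul1g (expg_dvdn1 BE Ea) (expg_dvdn1 BE Ec) mulg1 mul1g expgnDr.
have [S'1|nS'] := eqVneq S' 1.
  apply: (power (S * B)) => a b c Ea Eb Ec; exists (a + c)%N.
  by rewrite /twist S'1 !mul1g (expg_dvdn1 BE Eb) (expg_dvdn1 BE Ec) !mulg1 expgnDr.
have [B1|nB] := eqVneq B 1.
  apply: (power 1) => a b c Ea Eb Ec; exists 0%N.
  by rewrite /twist B1 !mulg1 (expg_dvdn1 SE Ea) (expg_dvdn1 S'E Eb) (expg_dvdn1 SE Ec)
     (expg_dvdn1 S'E Ec) !mulg1 expg0.
have [eSS'|nSS'] := eqVneq S S'.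
  apply: (power (S' * B)) => a b c Ea Eb Ec; exists (a + b + c + c)%N.
  by rewrite /twist eSS' !expgnDr.
have [f [i [s eS]]] := torsion_lett E0 SE.
have [||s' eS'] := @lett_centraliser _ commK i s (f^-1 * S' * f).
- by apply: contraNneq nS => s1; rewrite eS s1 lett1 mulg1 mulgV.
- move: cSS'; rewrite /commute eS => cSS'.
  apply: (mulgI f); apply: (mulIg f^-1).
  by rewrite !mulgA mulgK mulgV mul1g cSS' !mulgA.
have {}eS' : S' = f * lett i s' * f^-1 by rewrite -eS' !mulgA mulgV mul1g mulgK.
have [e [j [y eB]]] := torsion_lett E0 BE.
(* The factors being abelian, [x] can join the common conjugator [k] and [z] drops out of the
   conjugate of [lett j y]; only the core [c0] remains in [Y]. *)
have [x [z [c0 [ec ends_c]]]] := double_coset i j (f^-1 * e).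
pose Y := c0 * lett j y * c0^-1; pose k := f * lett i x.
have eY : B = k * Y * k^-1.
  have -> : k * Y * k^-1 = (k * c0 * lett j z) * lett j y * (k * c0 * lett j z)^-1.
    rewrite /Y !invgM !mulgA; congr (_ * _ * _).
    by rewrite -(mulgA _ (lett j z) (lett j y)) (lettC commK) mulgA mulgK.
  have -> : k * c0 * lett j z = e by rewrite /k -!mulgA (mulgA (lett i x)) -ec mulKVg.
  by [].
have kS t : f * lett i t * f^-1 = k * lett i t * k^-1.
  rewrite /k invgM !mulgA; congr (_ * _).
  by rewrite -(mulgA _ (lett i x)) (lettC commK) mulgA mulgK.
have ny : y != 1 by apply: contraNneq nB => y1; rewrite eB y1 lett1 mulg1 mulgV.
have ns : s != 1 by apply: contraNneq nS => s1; rewrite eS s1 lett1 mulg1 mulgV.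
have ns' : s' != 1 by apply: contraNneq nS' => s1; rewrite eS' s1 lett1 mulg1 mulgV.
have nss' : s != s' by apply: contraNneq nSS' => ss; rewrite eS eS' ss.
have tw a b c : twist S S' B a b c = k * twist (lett i s) (lett i s') Y a b c * k^-1.
  by rewrite eS eS' eY !kS twistJ.
(* In the first case all three elements lie in one conjugate of a factor, so the test word is
   torsion. *)
have [/andP[/eqP c00 /eqP ji]|ncj] := boolP ((fsq_val c0 == [::]) && (j == i)).
  exists 0%N => u v psi a b c u0 v0 [qp hp _] *; left; rewrite tw (homogeneousJ qp hp).
  have -> : Y = lett i y.
    by rewrite /Y ji (_ : c0 = 1) ?mul1g ?invg1 ?mulg1 //; apply: fsq_inj.
  rewrite /twist -!lettM -!(is_homX (lettM i)) -!lettM; set t := (_ * _).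
  by apply: (homogeneous_torsion hp (order_gt0 t)); rewrite -(is_homX (lettM i)) expg_order lett1.
have [] := @conj_lett_val c0 i j y ny ends_c.
  by move=> c00; move: ncj; rewrite c00.
rewrite -/Y => nY eY'.
have [J hJ] := twist_eventually ns ns' nss' nY eY'.
exists J => u v psi a b c Ju Jv hc _ _ _ a0 b0 cc0 cu cv.
have [qp hp _] := hc; rewrite tw (homogeneousJ qp hp).
exact: hJ.
Qed.

Definition fsq_proj i : fsq K -> K := fsq_ext (fun j x => if j == i then x else 1).

Lemma fsq_proj_aux i j : is_hom (fun x : K => if j == i then x else 1).
Proof. by move=> x y; case: eqP => // _; rewrite mulg1. Qed.

Lemma fsq_projM i : is_hom (fsq_proj i).
Proof. exact: fsq_extM (fsq_proj_aux i). Qed.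

Lemma fsq_proj_lett i j x : fsq_proj i (lett j x) = if j == i then x else 1.
Proof. exact: (fsq_ext_lett (fsq_proj_aux i)). Qed.

Lemma fsq_projJ i (c : fsq K) g : fsq_proj i (c * g * c^-1) = fsq_proj i g.
Proof.
by rewrite !fsq_projM (is_homV (fsq_projM i)) (commK (fsq_proj i c)) mulgK.
Qed.

(** Torsion is conjugate to one letter, and projections ignore conjugation, so a non-trivial
    coordinate identifies both the factor and the letter. *)
Lemma torsion_proj_neq1 g n i x : (0 < n)%N -> g ^+ n = 1 -> fsq_proj i g = x -> x != 1 ->
  exists c, g = c * lett i x * c^-1.
Proof.
move=> n0 gn; have [c [j [y ->]]] := torsion_lett n0 gn.
rewrite fsq_projJ fsq_proj_lett; case: eqP => [-> ->|_ <-]; last by rewrite eqxx.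
by exists c.
Qed.

Lemma torsion_proj_eq1 g n : (0 < n)%N -> g ^+ n = 1 -> (forall i, fsq_proj i g = 1) -> g = 1.
Proof.
move=> n0 gn; have [c [j [y ->]]] := torsion_lett n0 gn.
by move/(_ j); rewrite fsq_projJ fsq_proj_lett eqxx => ->; rewrite lett1 mulg1 mulgV.
Qed.
End Torsion.

(** * Maps from the graph product and averaging over automorphisms *)

Lemma is_hom_comp (A B C : groupType) (f : A -> B) (g : B -> C) :
  is_hom f -> is_hom g -> is_hom (g \o f).
Proof. by move=> hf hg x y; rewrite /= hf hg. Qed.

Lemma is_hom_conj (A B : groupType) (f : A -> B) (c : B) :
  is_hom f -> is_hom (fun x => c * f x * c^-1).
Proof. by move=> hf x y; rewrite hf !mulgA mulgKV. Qed.

Lemma commute_hom (A B : groupType) (f : A -> B) x y :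
  is_hom f -> commute x y -> commute (f x) (f y).
Proof. by move=> hf c; rewrite /commute -!hf c. Qed.

Lemma conj_cancel (A : groupType) (e c z l : A) : commute z l ->
  e^-1 * (e * c * z * l * (e * c * z)^-1) * e^-1^-1 = c * l * c^-1.
Proof.
move=> cz; rewrite !invgM invgK -(mulgA _ z l) cz !mulgA mulVg mul1g mulgK.
by rewrite mulgKV.
Qed.

(** Exponents must be multiples of [E]; the summands [2] and [c] keep them above [E] and above the
    bound [c]. *)
Definition level E c k := (E * (k + 2 + c))%N.

Lemma ltn_level E c k : (0 < E)%N -> (c < level E c k)%N /\ (E < level E c k)%N.
Proof.
move=> E0; split; last by rewrite -{1}[E]muln1 ltn_pmul2l //; lia.
by apply: (@leq_trans (1 * (k + 2 + c))%N); [lia|rewrite leq_mul2r E0 orbT].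
Qed.

(** Comparing [2k], [2k+1] with [2j], [2j+1], the first test amounts to [k <= j] and the second to
    [k < j]. *)
Lemma pattern_value_level E c k j : (0 < E)%N ->
  pattern_value (level E c k.*2) (level E c k.*2.+1) (level E c j.*2) (level E c j.*2.+1)
  = ((k == j)%N%:R)%R.
Proof.
move=> E0; rewrite /pattern_value /level !leq_pmul2l // !leq_add2r ltnS leq_double.
rewrite andbb leq_Sdouble ltn_double.
by case: ltngtP => _; rewrite ?subrr ?subr0.
Qed.

Section GraphProduct.
Variables (V : finType) (adj : rel V) (G : V -> finGroupType).
Hypothesis hgraph : simple_graph adj.
Hypothesis hab : forall v (x y : G v), commute x y.
Variables (W : groupType) (iota : forall v, G v -> W).
Hypothesis hW : @is_graph_product V adj (fun v => G v : groupType) W iota.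

Lemma iotaM v : is_hom (@iota v). Proof. by case: hW => h _; exact: h. Qed.

Lemma iota_adj u v (x : G u) (y : G v) : adj u v -> commute (iota x) (iota y).
Proof. by move=> uv; case: hW => _ [h _]; exact: h. Qed.

Lemma graph_product_ext (H : groupType) (f g : W -> H) : is_hom f -> is_hom g ->
  (forall v (x : G v), f (iota x) = g (iota x)) -> forall w, f w = g w.
Proof.
move=> hf hg e w; have [_ [_ U]] := hW.
have [|u v uv x y|h [hh [_ hu]]] := U H (fun v x => g (iota x)).
- by move=> v x y; rewrite iotaM hg.
- exact/commute_hom/iota_adj.
by rewrite (hu f hf e) (hu g hg (fun v x => erefl)).
Qed.

(** The finite abelianisation of [W]. It also supplies the letters of both free factors, with [A]
    and [B] sitting inside as coordinate subgroups. *)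
Definition Kab := {dffun forall v, G v}.

Lemma Kab_comm (x y : Kab) : commute x y.
Proof. by apply/ffunP => v; rewrite !dffunM; exact: hab. Qed.

Lemma dfung1_eq1 v (x : G v) : dfung1 x = 1 :> Kab -> x = 1.
Proof. by move/(congr1 (fun k : Kab => k v)); rewrite dfung1_id ffunE. Qed.

Lemma abelianisation_exists : exists ab : W -> Kab,
  is_hom ab /\ forall v (x : G v), ab (iota x) = dfung1 x.
Proof.
have [_ [_ U]] := hW.
have [|u v uv x y|h [hh [hi _]]] := U Kab (fun v x => dfung1 x).
- by move=> v x y; exact: dfung1_morphM.
- exact: Kab_comm.
by exists h.
Qed.

Variable ab : W -> Kab.
Hypotheses (abM : is_hom ab) (ab_iota : forall v (x : G v), ab (iota x) = dfung1 x).

Variables a b d : V.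
Hypotheses (stab : a = b \/ adj a b) (da : d != a) (db : d != b).
Hypotheses (nda : ~~ adj d a) (ndb : ~~ adj d b).

Definition factor v : option bool :=
  if v \in [:: a; b] then Some false else if v == d then Some true else None.

Definition pi_gen v (x : G v) : fsq Kab :=
  if factor v is Some i then lett i (dfung1 x) else 1.

(** The vertex [d] lies outside the stars of [a] and [b], so no commutation relation links the two
    free factors. *)
Lemma factor_adj u v i j : adj u v -> factor u = Some i -> factor v = Some j -> i = j.
Proof.
have [symm irr] := hgraph; rewrite /factor !inE => uv.
case: ifP => [hu [<-]|_].
  case: ifP => [_ [<-] //|_]; case: eqP => // ev [<-].
  by move: uv hu; rewrite ev symm => uv /orP[]/eqP eu; rewrite eu ?(negPf nda) ?(negPf ndb) in uv.
case: eqP => // eu [<-]; case: ifP => [hv|_].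
  by move: uv hv; rewrite eu => uv /orP[]/eqP ev; rewrite ev ?(negPf nda) ?(negPf ndb) in uv.
by case: eqP => // _ [<-].
Qed.

Lemma pi_exists : exists pi : W -> fsq Kab,
  is_hom pi /\ forall v (x : G v), pi (iota x) = pi_gen x.
Proof.
have [_ [_ U]] := hW.
have [|u v uv x y|h [hh [hi _]]] := U (fsq Kab) pi_gen.
- move=> v x y; rewrite /pi_gen; case: factor => [i|]; last by rewrite mulg1.
  by rewrite (dfung1_morphM x y) lettM.
- rewrite /pi_gen; case eu: (factor u) => [i|]; last by rewrite /commute mul1g mulg1.
  case ev: (factor v) => [j|]; last by rewrite /commute mul1g mulg1.
  by rewrite (factor_adj uv eu ev); exact: (lettC Kab_comm).
by exists h.
Qed.

Variable pi : W -> fsq Kab.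
Hypotheses (piM : is_hom pi) (pi_iota : forall v (x : G v), pi (iota x) = pi_gen x).

Definition restr i (k : Kab) : Kab := [ffun v => if factor v == Some i then k v else 1].

Lemma restrM i : is_hom (restr i).
Proof.
move=> x y; apply/ffunP => v; transitivity (restr i x v * restr i y v).
  by rewrite !ffunE; case: ifP; rewrite ?mulg1.
by rewrite -dffunM.
Qed.

Lemma restr_dfung1 i v (x : G v) :
  restr i (dfung1 x) = if factor v == Some i then dfung1 x else 1.
Proof.
apply/ffunP => u; rewrite ffunE.
have [<-{u}|nvu] := eqVneq v u; first by case: ifP => _; rewrite // ffunE.
by rewrite dfung1_dflt // if_same; case: ifP => _; rewrite ?dfung1_dflt ?ffunE.
Qed.

(** Hence the coordinates of [pi w] do not change under a map acting trivially on the
    abelianisation. *)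
Lemma proj_pi i w : fsq_proj i (pi w) = restr i (ab w).
Proof.
apply: (graph_product_ext (is_hom_comp piM (@fsq_projM _ i)) (is_hom_comp abM (restrM i))).
move=> v x; rewrite /= pi_iota ab_iota restr_dfung1 /pi_gen.
case: (factor v) => [j|]; last by rewrite (is_hom1 (@fsq_projM _ i)).
exact: fsq_proj_lett.
Qed.

Variables (sa : G a) (sd : G d).
Hypotheses (nsa : sa != 1) (nsd : sd != 1).

Lemma factor_a : factor a = Some false. Proof. by rewrite /factor !inE eqxx. Qed.
Lemma factor_d : factor d = Some true.
Proof. by rewrite /factor !inE (negPf da) (negPf db) eqxx. Qed.

Lemma iota_commute_a v (x : G v) : factor v = Some false -> commute (iota sa) (iota x).
Proof.
rewrite /factor !inE; case: ifP => [|_]; last by case: eqP.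
case/orP=> /eqP ev _; first by subst v; apply: commute_hom; [exact: iotaM|exact: hab].
case: stab => [eab|/iota_adj]; last by move: x; rewrite ev => x; apply.
by move: x; rewrite ev -eab => x; apply: commute_hom; [exact: iotaM|exact: hab].
Qed.

Lemma iota_commute_d v (x : G v) : factor v = Some true -> commute (iota sd) (iota x).
Proof.
rewrite /factor; case: ifP => // _; case: eqP => // ev _; subst v.
by apply: commute_hom; [exact: iotaM|exact: hab].
Qed.

(* An endomorphism inducing the identity on the abelianisation sends torsion to torsion with the
   same abelian image, so it conjugates each of the two free factors; surjectivity makes the two
   conjugators agree. *)
Lemma pi_torelli (chi : W -> W) : is_hom chi -> (forall w, exists w', chi w' = w) ->
  (forall w, ab (chi w) = ab w) -> exists e, forall w, pi (chi w) = e * pi w * e^-1.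
Proof.
move=> chiM chiS chiab; pose P := pi \o chi.
have PM : is_hom P := is_hom_comp chiM piM.
have Pproj i w : fsq_proj i (P w) = restr i (ab w) by rewrite proj_pi chiab.
have Ptors v (x : G v) : P (iota x) ^+ #[x] = 1.
  by rewrite -(is_homX PM) -(is_homX (@iotaM v)) expg_order (is_hom1 (@iotaM v)) (is_hom1 PM).
have conj i v0 (x0 : G v0) : factor v0 = Some i -> x0 != 1 ->
    (forall v (x : G v), factor v = Some i -> commute (iota x0) (iota x)) ->
    exists c, forall v (x : G v), factor v = Some i -> P (iota x) = c * lett i (dfung1 x) * c^-1.
  move=> f0 nx0 hc.
  have nd0 : dfung1 x0 != 1 :> Kab by apply: contraNneq nx0 => /dfung1_eq1 ->.
  have [|c ec] := torsion_proj_neq1 Kab_comm (order_gt0 x0) (Ptors _ x0) _ nd0 (i := i).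
    by rewrite Pproj ab_iota restr_dfung1 f0 eqxx.
  exists c => v x fv.
  have [|k ek] := @lett_centraliser _ Kab_comm i _ (c^-1 * P (iota x) * c) nd0.
    have := commute_hom PM (hc v x fv); rewrite /commute ec => cc.
    apply: (mulgI c); apply: (mulIg c^-1).
    by rewrite !mulgA mulgK mulgV mul1g cc !mulgA.
  have e1 : P (iota x) = c * lett i k * c^-1 by rewrite -ek !mulgA mulgV mul1g mulgK.
  have := Pproj i (iota x).
  by rewrite {1}e1 (fsq_projJ Kab_comm) fsq_proj_lett eqxx ab_iota restr_dfung1 fv eqxx e1 => ->.
have [c1 h1] := conj false a sa factor_a nsa iota_commute_a.
have [c2 h2] := conj true d sd factor_d nsd iota_commute_d.
have [x [z [c [ec ends_c]]]] := double_coset false true (c1^-1 * c2).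
pose e := c1 * lett false x.
have ec2 : c2 = e * c * lett true z by rewrite /e -!mulgA (mulgA (lett false x)) -ec mulKVg.
have eP : forall w, e^-1 * P w * e^-1^-1 = spread c (pi w).
  apply: (graph_product_ext (is_hom_conj _ PM) (is_hom_comp piM (spreadM c))) => v t /=.
  rewrite pi_iota /pi_gen; case fv: (factor v) => [[]|].
  - rewrite (h2 _ _ fv) ec2 spread_lettE conj_cancel //.
    exact: lettC Kab_comm _ _ _.
  - rewrite (h1 _ _ fv) spread_lettE.
    have -> : c1 = e * 1 * (lett false x)^-1 by rewrite mulg1 /e mulgK.
    rewrite conj_cancel ?invg1 ?mulg1 ?mul1g //.
    by rewrite -lettV; exact: lettC Kab_comm _ _ _.
  rewrite (is_hom1 (spreadM c)).
  (* A killed vertex group goes to torsion with both coordinates trivial. *)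
  suff -> : P (iota t) = 1 by rewrite mulg1 mulgV.
  apply: (torsion_proj_eq1 Kab_comm (order_gt0 t) (Ptors _ t)) => i.
  by rewrite Pproj ab_iota restr_dfung1 fv.
(* If [c] were non-trivial, [spread c] would hit no conjugate of a product of two non-trivial
   letters, contrary to surjectivity. *)
have [w1 ew1] := chiS (iota sa * iota sd).
have c1E : fsq_val c = [::].
  apply: (@spread_not_conj _ c (dfung1 sa) (dfung1 sd) (pi w1) e^-1 ends_c).
  - by apply: contraNneq nsa => /dfung1_eq1 ->.
  - by apply: contraNneq nsd => /dfung1_eq1 ->.
  by rewrite -eP /P /= ew1 piM !pi_iota /pi_gen factor_a factor_d.
have {c1E} cE : c = 1 by apply: fsq_inj.
clear ec2; clearbody e; exists e => w; apply: (graph_product_ext PM (is_hom_conj e piM)) => v t.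
have := eP (iota t); rewrite pi_iota cE invgK => /(congr1 (fun g => e * g * e^-1)).
rewrite !mulgA mulgV mul1g mulgK => ->; congr (_ * _ * _).
rewrite /pi_gen; case: (factor v) => [i|]; last by rewrite (is_hom1 (spreadM 1)).
by rewrite spread_lettE /spread_lett; case: i; rewrite // invg1 mulg1 mul1g.
Qed.

(** * Classes of automorphisms and averaging *)

Definition automorphism (phi : W -> W) := is_hom phi /\ bijective phi.

(** Values on the vertex groups determine the map to the abelianisation, and they live in a finite
    type, so there are finitely many classes. *)
Definition ab_type (phi : W -> W) : {ffun {v : V & G v} -> Kab} :=
  [ffun t => ab (phi (iota (tagged t)))].

Lemma ab_typeP phi phi' : automorphism phi -> automorphism phi' ->
  ab_type phi = ab_type phi' -> forall w, ab (phi w) = ab (phi' w).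
Proof.
move=> [pM _] [p'M _] e; apply: (graph_product_ext (is_hom_comp pM abM) (is_hom_comp p'M abM)).
move=> v x; have := congr1 (fun f : {ffun {v : V & G v} -> Kab} => f (Tagged G x)) e.
by rewrite !ffunE.
Qed.

Lemma automorphism_id : automorphism id.
Proof. by split=> //; exists id. Qed.

Lemma automorphism_comp phi phi' : automorphism phi -> automorphism phi' -> automorphism (phi \o phi').
Proof. by move=> [hM hb] [h'M h'b]; split; [exact: is_hom_comp|exact: bij_comp]. Qed.

Lemma automorphism_inv phi : automorphism phi ->
  exists phi', [/\ automorphism phi', cancel phi phi' & cancel phi' phi].
Proof.
case=> hM [phi' pK p'K]; exists phi'; split=> //; split; last by exists phi.
by move=> x y; apply: (can_inj pK); rewrite hM !p'K.
Qed.

(** The composite of [phi'] with the inverse of [phi] acts trivially on the abelianisation, so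
    [pi_torelli] applies to it. *)
Lemma pi_ab_type phi phi' : automorphism phi -> automorphism phi' ->
  ab_type phi = ab_type phi' -> exists e, forall w, pi (phi' w) = e * pi (phi w) * e^-1.
Proof.
move=> ap ap' e; have [q [aq pq qp]] := automorphism_inv ap.
have [r [ar p'r rp']] := automorphism_inv ap'.
have [qM _] := aq; have [p'M _] := ap'.
have [||f hf] := @pi_torelli (phi' \o q) (is_hom_comp qM p'M).
- by move=> w; exists (phi (r w)); rewrite /= pq rp'.
- by move=> w /=; rewrite -(ab_typeP ap ap' e) qp.
by exists f => w; rewrite -hf /= pq.
Qed.

Definition realised t := if excluded_middle_informative (exists phi, automorphism phi /\ ab_type phi = t)
  then true else false.

Lemma realisedP t : reflect (exists phi, automorphism phi /\ ab_type phi = t) (realised t).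
Proof. by rewrite /realised; case: excluded_middle_informative => h; constructor. Qed.

Lemma representatives : exists rep : {ffun {v : V & G v} -> Kab} -> W -> W,
  forall t, realised t -> automorphism (rep t) /\ ab_type (rep t) = t.
Proof.
have h t : exists phi, realised t -> automorphism phi /\ ab_type phi = t.
  by case: (boolP (realised t)) => [/realisedP[phi h]|_]; [exists phi|exists id].
exists (fun t => proj1_sig (constructive_indefinite_description _ (h t))) => t.
by case: constructive_indefinite_description.
Qed.

Variable rep : {ffun {v : V & G v} -> Kab} -> W -> W.
Hypothesis repP : forall t, realised t -> automorphism (rep t) /\ ab_type (rep t) = t.

Definition average (psi : fsq Kab -> RR) (w : W) : RR :=
  (\sum_(t | realised t) psi (pi (rep t w)))%R.

Section Average.
Variable psi : fsq Kab -> RR.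
Hypotheses (qpsi : quasimorphism psi) (hpsi : homogeneous psi).

Lemma psi_ab_type phi phi' w : automorphism phi -> automorphism phi' ->
  ab_type phi = ab_type phi' -> psi (pi (phi w)) = psi (pi (phi' w)).
Proof.
move=> ap ap' e; have [f hf] := pi_ab_type ap ap' e.
by rewrite hf (homogeneousJ qpsi hpsi).
Qed.

Lemma pi_repM t : realised t -> is_hom (pi \o rep t).
Proof. by move=> /repP[[rM _] _]; exact: is_hom_comp. Qed.

Lemma average_quasimorphism : quasimorphism (average psi).
Proof.
have [D hD] := qpsi; exists (\sum_(t | realised t) D)%R => g h.
rewrite /average -big_split -sumrB /=; apply: le_trans (ler_norm_sum _ _ _) _.
apply: ler_sum => t rt; have := pi_repM rt g h => /= ->; exact: hD.
Qed.

Lemma average_homogeneous : homogeneous (average psi).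
Proof.
move=> g n; rewrite /average mulr_sumr -sumrN; split; apply: eq_bigr => t rt.
  by have /= -> := is_homX (pi_repM rt) g n; rewrite (homogeneousX hpsi).
have /= -> := is_homV (pi_repM rt) (g ^+ n); have /= -> := is_homX (pi_repM rt) g n.
by rewrite (homogeneousV hpsi) (homogeneousX hpsi).
Qed.

Lemma average_aut_invariant : aut_invariant (average psi).
Proof.
move=> th thM thB g; have ath : automorphism th by [].
(* Composition with [th] permutes the realised types. The others are fixed, so that [T] is injective
   on the whole finite type, as reindexing demands. *)
pose T t := if realised t then ab_type (rep t \o th) else t.
have aT t : realised t -> automorphism (rep t \o th).
  by move=> /repP[at_ _]; exact: automorphism_comp.
have rT t : realised (T t) = realised t.
  rewrite /T; case: ifP => // rt; apply/realisedP; exists (rep t \o th); split=> //; exact: aT.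
have [th' [ath' thK th'K]] := automorphism_inv ath.
have injT : injective T.
  move=> t t' e; have ert : realised t = realised t' by rewrite -rT e rT.
  move: e; rewrite /T -ert; case: ifP => // rt e.
  have rt' : realised t' by rewrite -ert.
  have [_ <-] := repP rt; have [_ <-] := repP rt'.
  apply/ffunP => x; rewrite !ffunE -(th'K (iota _)).
  exact: (ab_typeP (aT _ rt) (aT _ rt') e).
rewrite /average [RHS](reindex_inj injT) /=; apply: eq_big => [t|t rt]; first by rewrite rT.
have rTt : realised (T t) by rewrite rT.
have [aTt eTt] := repP rTt.
rewrite -[LHS]/(psi (pi ((rep t \o th) g))); apply: psi_ab_type => //; first exact: aT.
by rewrite eTt /T rt.
Qed.
End Average.

Variables (s s' y : W) (E : nat) (ks ks' ky : Kab).
Hypotheses (E0 : (0 < E)%N) (sE : s ^+ E = 1) (s'E : s' ^+ E = 1) (yE : y ^+ E = 1).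
Hypotheses (css' : commute s s').
Hypotheses (pis : pi s = lett false ks) (pis' : pi s' = lett false ks') (piy : pi y = lett true ky).
Hypotheses (nks : ks != 1) (nks' : ks' != 1) (nkss' : ks != ks') (nky : ky != 1).

Definition wtwist m n k : W := (s * y) ^+ m * (s' * y) ^+ n * (s * y) ^+ k * (s' * y) ^+ k.

Lemma hom_wtwist (f : W -> fsq Kab) m n k : is_hom f ->
  f (wtwist m n k) = twist (f s) (f s') (f y) m n k.
Proof. by move=> fM; rewrite /wtwist /twist !fM !(is_homX fM) !fM. Qed.

Lemma rep_dichotomy : exists J, forall t u v psi m n k, realised t ->
    (J < u)%N -> (J < v)%N -> homog_code u v psi ->
    (E %| m)%N -> (E %| n)%N -> (E %| k)%N ->
    (0 < m)%N -> (0 < n)%N -> (0 < k)%N -> (k < u)%N -> (k < v)%N ->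
    psi (pi (rep t (wtwist m n k))) = 0%R \/
    psi (pi (rep t (wtwist m n k))) = pattern_value u v m n.
Proof.
have h t : exists J, realised t -> forall u v psi m n k,
    (J < u)%N -> (J < v)%N -> homog_code u v psi ->
    (E %| m)%N -> (E %| n)%N -> (E %| k)%N ->
    (0 < m)%N -> (0 < n)%N -> (0 < k)%N -> (k < u)%N -> (k < v)%N ->
    psi (pi (rep t (wtwist m n k))) = 0%R \/
    psi (pi (rep t (wtwist m n k))) = pattern_value u v m n.
  have [rt|nrt] := boolP (realised t); last by exists 0%N.
  have fM := pi_repM rt.
  have fE x : x ^+ E = 1 -> pi (rep t x) ^+ E = 1.
    by move=> xE; have /= <- := is_homX fM x E; rewrite xE; have /= -> := is_hom1 fM.
  have [J hJ] := twist_dichotomy Kab_comm E0 (fE _ sE) (fE _ s'E) (fE _ yE) (commute_hom fM css').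
  exists J => _ u v psi m n k; have /= -> := hom_wtwist m n k fM; exact: hJ.
pose J t := proj1_sig (constructive_indefinite_description _ (h t)).
(* Finitely many types, hence one bound for all representatives. *)
exists (\max_t J t) => t u v psi m n k rt Ju Jv.
have := leq_bigmax (F := J) t; rewrite {1}/J.
case: constructive_indefinite_description => j hj /= le_j.
by apply: hj => //; apply: leq_ltn_trans le_j _.
Qed.

Lemma id_value u v psi m n k : (0 < u)%N -> (0 < v)%N -> homog_code u v psi ->
    (0 < m)%N -> (0 < n)%N -> (0 < k)%N -> (k < u)%N -> (k < v)%N ->
    psi (pi (wtwist m n k)) = pattern_value u v m n.
Proof.
move=> u0 v0 hc m0 n0 k0 ku kv.
rewrite (hom_wtwist _ _ _ piM) pis pis' piy.
have vy : fsq_val (lett true ky) = [:: (true, ky)] by rewrite lett_valE (negPf nky).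
by apply: (homog_code_twist u0 v0 hc); rewrite ?vy.
Qed.

(** By the dichotomy each summand of the average of [f k] at [g j] is 0 or the Kronecker delta of
    [k] and [j]. The matrix of values is therefore diagonal, and the class of the identity makes its
    diagonal positive. *)
Lemma independent_family : exists psi : nat -> W -> RR,
  (forall i, quasimorphism (psi i) /\ homogeneous (psi i) /\ aut_invariant (psi i)) /\
  lin_indep_family psi.
Proof.
have [J hJ] := rep_dichotomy.
pose u k := level E J k.*2; pose v k := level E J k.*2.+1.
have [Ju Eu] : (forall k, J < u k)%N /\ (forall k, E < u k)%N.
  by split=> k; have [] := ltn_level J k.*2 E0.
have [Jv Ev] : (forall k, J < v k)%N /\ (forall k, E < v k)%N.
  by split=> k; have [] := ltn_level J k.*2.+1 E0.
have u0 k : (0 < u k)%N by apply: leq_ltn_trans (Ju k).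
have v0 k : (0 < v k)%N by apply: leq_ltn_trans (Jv k).
pose f k := proj1_sig (constructive_indefinite_description _ (@homog_code_exists Kab _ _ (u0 k) (v0 k))).
have hf k : homog_code (u k) (v k) (f k).
  by rewrite /f; case: constructive_indefinite_description.
pose g j := wtwist (u j) (v j) E.
have valE k j : pattern_value (u k) (v k) (u j) (v j) = ((k == j)%N%:R)%R.
  exact: pattern_value_level.
have dich t k j : realised t -> f k (pi (rep t (g j))) = 0%R \/ f k (pi (rep t (g j))) = ((k == j)%N%:R)%R.
  move=> rt; rewrite -valE; apply: (hJ _ _ _ _ _ _ _ rt (Ju k) (Jv k) (hf k)) => //.
  - exact: dvdn_mulr.
  - exact: dvdn_mulr.
exists (fun k => average (f k)); split=> [k|].
  have [qf hmf _] := hf k; split; first exact: average_quasimorphism.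
  by split; [exact: average_homogeneous|exact: average_aut_invariant].
move=> n c hc j; have := hc (g j); rewrite (bigD1 j) //= big1 ?addr0 => [|i nij]; last first.
  rewrite /average big1 ?mulr0 // => t rt; case: (dich t i j rt) => -> //.
  by rewrite (negPf (_ : (i : nat) != j)).
move/eqP; rewrite mulf_eq0 => /orP[/eqP //|]; rewrite gt_eqF //.
have rid : realised (ab_type id) by apply/realisedP; exists id; split=> //; exact: automorphism_id.
rewrite /average (bigD1 (ab_type id)) //=.
have [aid tid] := repP rid; have [qf hmf _] := hf j.
(* The representative of this class need not be the identity, but values agree within a class. *)
rewrite (psi_ab_type qf hmf (g j) aid automorphism_id tid).
rewrite (id_value (u0 j) (v0 j) (hf j)) // valE eqxx.
apply: ltr_wpDr => //; apply: sumr_ge0 => t /andP[rt _].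
by case: (dich t j j rt) => ->.
Qed.
End GraphProduct.

(** * Complete multipartite graphs *)

Section Generation.
Variables (W : groupType) (A B : W -> Prop).

Definition genb w := if excluded_middle_informative (gen A w) then true else false.

Lemma genP w : reflect (gen A w) (genb w).
Proof. by rewrite /genb; case: excluded_middle_informative => h; constructor. Qed.

Lemma genb_closed : group_closed genb.
Proof.
split; first by apply/genP; exact: gen_one.
by move=> x y /genP hx /genP hy; apply/genP/gen_mul => //; exact: gen_inv.
Qed.

(** A group type for the generated subgroup, so that it can be a target of the universal
    property. *)
Record gsub := Gsub { gsub_val :> W; _ : genb gsub_val }.
HB.instance Definition _ := [isSub for gsub_val].
HB.instance Definition _ := [Choice of gsub by <:].
HB.instance Definition _ := SubChoice_isSubGroup.Build W genb gsub genb_closed.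

Lemma commuteV (x y : W) : commute x y -> commute x y^-1.
Proof.
by move=> c; apply: (mulgI y); apply: (mulIg y); rewrite !mulgA mulgV mul1g mulgKV c.
Qed.

Lemma gen_commute : (forall x y, A x -> B y -> commute x y) ->
  forall x y, gen A x -> gen B y -> commute x y.
Proof.
move=> c x y gx gy; elim: gx => {x} [x Ax||x x' _ IH _ IH'|x _ IH].
- elim: gy => {y} [y By||y y' _ IH _ IH'|y _ IH]; first exact: c.
  + by rewrite /commute mul1g mulg1.
  + by rewrite /commute mulgA IH -mulgA IH' mulgA.
  + exact: commuteV.
- by rewrite /commute mul1g mulg1.
- by rewrite /commute -mulgA IH' mulgA IH mulgA.
- by apply/commute_sym/commuteV/commute_sym.
Qed.
End Generation.

Lemma prodM_commute (W : groupType) (I : eqType) (r : seq I) (x y : I -> W) : uniq r ->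
  (forall i j, i != j -> commute (x i) (y j)) ->
  \prod_(i <- r) (x i * y i) = \prod_(i <- r) x i * \prod_(i <- r) y i.
Proof.
move=> ur c; elim: r ur => [|i r IH] /=; first by rewrite !big_nil mulg1.
case/andP=> ni /IH e; rewrite !big_cons e -!mulgA; congr (_ * _); rewrite !mulgA; congr (_ * _).
elim: r ni {IH e} => [|j r IH]; first by rewrite !big_nil mulg1 mul1g.
rewrite inE negb_or => /andP[nij /IH e].
by rewrite big_cons mulgA -(c j i) 1?eq_sym // -mulgA e mulgA.
Qed.

Section Multipartite.
Variables (V : finType) (adj : rel V) (G : V -> finGroupType).
Hypotheses (hV : (0 < #|V|)%N) (hgraph : simple_graph adj).
Hypothesis hab : forall v (x y : G v), commute x y.
Hypothesis hnontriv : forall v, (1 < #|G v|)%N.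
Variables (W : groupType) (iota : forall v, G v -> W).
Hypothesis hW : @is_graph_product V adj (fun v => G v : groupType) W iota.

(** The universal property maps [W] to the generated subgroup; followed by the inclusion this fixes
    the generators, so it is the identity by uniqueness. *)
Lemma graph_product_gen w : gen (fun w => exists v (x : G v), w = iota x) w.
Proof.
set A := fun w => _; have [_ [_ U]] := hW.
have inA v (x : G v) : genb A (iota x) by apply/genP/gen_base; exists v, x.
have [v x y|u v uv x y|h [hh [hi _]]] := U (gsub A) (fun v x => Gsub (inA v x)).
- by apply: val_inj; rewrite [RHS]gmulfM; exact: (iotaM hW).
- by apply: val_inj; rewrite [LHS]gmulfM [RHS]gmulfM; exact: (iota_adj hW).
suff <- : val (h w) = w by apply/genP; exact: (valP (h w)).
apply: (graph_product_ext hW (f := val \o h) (g := id)) => //.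
- by move=> x y; rewrite /comp hh; exact: gmulfM.
- by move=> v x; rewrite /= hi.
Qed.

Hypothesis multipartite : forall a b d, a = b \/ adj a b -> d != a -> d != b ->
  ~~ adj d a -> ~~ adj d b -> a = b /\ (#|G a| <= 2)%N.

Let sym : symmetric adj. Proof. by case: hgraph. Qed.
Let irr : irreflexive adj. Proof. by case: hgraph. Qed.

(** An edge from [u] to [w] with [v] outside both stars is an excluded triple: it would force
    [u = w]. *)
Lemma nonadj_trans v : forall u w, ~~ adj u v -> ~~ adj v w -> ~~ adj u w.
Proof.
move=> u w nuv nvw; apply/negP => uw.
have [vu|vu] := eqVneq v u; first by rewrite vu uw in nvw.
have [vw|vw] := eqVneq v w; first by rewrite vw uw in nuv.
have [|euw _] := @multipartite u w v (or_intror uw) vu vw _ nvw; first by rewrite sym.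
by rewrite euw irr in uw.
Qed.

(** A canonical representative of the class of [v], as equal predicates give equal picks. The
    default is never reached: [v] is not adjacent to itself. *)
Definition part_root v := odflt v [pick u | ~~ adj v u].

Lemma part_root_eq u v : (part_root u == part_root v) = ~~ adj u v.
Proof.
have rootP w : ~~ adj w (part_root w).
  by rewrite /part_root; case: pickP => //= _; rewrite irr.
apply/eqP/idP => [e|nuv].
  by apply: (nonadj_trans (rootP u)); rewrite e sym; exact: rootP.
rewrite /part_root; have e : (fun w => ~~ adj u w) =1 (fun w => ~~ adj v w).
  move=> w; apply/idP/idP; last exact: nonadj_trans.
  by apply: nonadj_trans; rewrite sym.
rewrite (eq_pick e); case: pickP => //= /(_ v); by rewrite irr.
Qed.

Lemma multipartite_index : exists l (p : V -> 'I_l),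
  (forall i, exists v, p v = i) /\ forall u v, (p u == p v) = ~~ adj u v.
Proof.
have [v0 _] : exists v0 : V, v0 \in V by apply/card_gt0P.
have r0 : part_root v0 \in part_root @: V by apply: imset_f.
exists #|part_root @: V|, (fun v => enum_rank_in r0 (part_root v)); split.
  move=> i; have := enum_valP i => /imsetP[v _ ev].
  by exists v; rewrite -ev enum_valK_in.
move=> u v; rewrite -part_root_eq; apply/eqP/eqP => [|-> //].
by move/(congr1 enum_val); rewrite !enum_rankK_in ?imset_f.
Qed.

Variables (l : nat) (p : V -> 'I_l).
Hypotheses (psurj : forall i, exists v, p v = i) (pE : forall u v, (p u == p v) = ~~ adj u v).
Local Notation S i := (sub_gp iota (fun v => p v == i)).

Lemma part_commute i j x y : i != j -> S i x -> S j y -> commute x y.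
Proof.
move=> nij; apply: gen_commute => {x y} _ _ [u [x [/eqP eu ->]]] [v [y [/eqP ev ->]]].
by apply: (iota_adj hW); rewrite -[adj u v]negbK -pE eu ev.
Qed.

Lemma part_retraction i : exists r : W -> W, is_hom r /\
  forall v (x : G v), r (iota x) = if p v == i then iota x else 1.
Proof.
have [_ [_ U]] := hW.
have [v x y|u v uv x y|h [hh [hi _]]] := U W (fun v x => if p v == i then iota x else 1).
- by case: ifP => _; rewrite ?mulg1 //; exact: (iotaM hW).
- case: ifP => _; last by rewrite /commute mul1g mulg1.
  by case: ifP => _; [exact: (iota_adj hW)|rewrite /commute mul1g mulg1].
by exists h.
Qed.

(** Killing all other parts gives retractions [r i]. Their product is a homomorphism, since distinct
    parts commute, and fixes the generators: this is existence. Applying [r i] to a product recovers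
    its factor: this is uniqueness. *)
Lemma multipartite_decomposition : product_decomposition iota p.
Proof.
pose r i := proj1_sig (constructive_indefinite_description _ (part_retraction i)).
have rP i : is_hom (r i) /\ forall v (x : G v), r i (iota x) = if p v == i then iota x else 1.
  by rewrite /r; case: constructive_indefinite_description.
have rS i j w : S j w -> r i w = if j == i then w else 1.
  have [rM ri] := rP i; elim=> {w} [w [v [x [/eqP <- ->]]]||w w' _ IH _ IH'|w _ IH].
  - exact: ri.
  - by rewrite (is_hom1 rM) if_same.
  - by rewrite rM IH IH'; case: ifP; rewrite ?mulg1.
  - by rewrite (is_homV rM) IH; case: ifP; rewrite ?invg1.
have rin i w : S i (r i w).
  have [rM ri] := rP i; elim: (graph_product_gen w) => {w} [_ [v [x ->]]||w w' _ IH _ IH'|w _ IH].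
  - rewrite ri; case: ifP => pv; last exact: gen_one.
    by apply: gen_base; exists v, x.
  - by rewrite (is_hom1 rM); exact: gen_one.
  - by rewrite rM; exact: gen_mul.
  - by rewrite (is_homV rM); exact: gen_inv.
split=> //; split; first by move=> i j nij x y; exact: part_commute.
split=> [w|ws ws' hws hws' e i].
  exists (fun i => r i w); split=> //.
  apply: (graph_product_ext hW (f := id) (g := fun w => \prod_(i < l) r i w)) => //.
    move=> x y; rewrite -prodM_commute ?index_enum_uniq //.
      by apply: eq_bigr => i _; have [rM _] := rP i; exact: rM.
    by move=> i j nij; apply: (part_commute nij); exact: rin.
  move=> v x; rewrite (big_only1 (p v)) //.
    by have [_ ->] := rP (p v); rewrite eqxx.
  by move=> j nj _; have [_ ->] := rP j; rewrite eq_sym (negPf nj).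
have proj vs : (forall i, S i (vs i)) -> r i (\prod_(i < l) vs i) = vs i.
  move=> hvs; have [rM _] := rP i; rewrite (big_morph _ rM (is_hom1 rM)) (big_only1 i) //.
    by rewrite (rS _ _ _ (hvs i)) eqxx.
  by move=> j nj _; rewrite (rS _ _ _ (hvs j)) (negPf nj).
by rewrite -(proj ws) // e proj.
Qed.

Lemma part_singleton i v : p v = i -> (forall u, p u = i -> u = v) -> finite_abelian_sub (S i).
Proof.
move=> pv uv.
have Sv w : S i w -> exists x : G v, w = iota x.
  elim=> {w} [_ [u [x [/eqP pu ->]]]||_ _ _ [x ->] _ [y ->]|_ _ [x ->]].
  - by have eu := uv u pu; move: x; rewrite eu => x; exists x.
  - by exists 1; rewrite (is_hom1 (iotaM hW (v := v))).
  - by exists (x * y); rewrite (iotaM hW).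
  - by exists x^-1; rewrite (is_homV (iotaM hW (v := v))).
split; last by move=> a b /Sv[x ->] /Sv[y ->]; apply: commute_hom; [exact: (iotaM hW)|exact: hab].
exists #|G v|, (fun k => iota (enum_val k)) => w /Sv[x ->].
by exists (enum_rank x); rewrite enum_rankK.
Qed.

Definition nonid v : G v := odflt 1 [pick x : G v | x != 1].

Lemma nonid_neq1 v : nonid v != 1.
Proof.
rewrite /nonid; case: pickP => //= h; have := hnontriv v.
by case/card_gt1P => x [y [_ _]]; have := h x; have := h y; do 2 move/negbFE/eqP->; rewrite eqxx.
Qed.

Lemma order2 v (x : G v) : (#|G v| <= 2)%N -> x = 1 \/ x = nonid v.
Proof.
move=> le2; have [->|nx] := eqVneq x 1; [by left|right].
apply/eqP; apply: contraLR le2 => nxi; rewrite -ltnNge; apply/card_gt2P.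
by exists 1, x, (nonid v); split; split; rewrite // ?(eq_sym 1) // nonid_neq1.
Qed.

Lemma nonid_sqr v : (#|G v| <= 2)%N -> nonid v * nonid v = 1.
Proof.
move=> /(order2 (nonid v * nonid v))[//|e].
by have := nonid_neq1 v; rewrite -[X in X != _](mulKg (nonid v)) e mulVg eqxx.
Qed.

(** Every vertex [w] of the part has another vertex [z] outside its star, and the triple [w], [w],
    [z] bounds the order of [G w] by 2. The part spans no edge, so the universal property of [W]
    gives that of the free product. *)
Lemma part_Zk i u v : p u = i -> p v = i -> u != v -> exists k, (0 < k)%N /\ iso_Zk (S i) k.
Proof.
move=> pu pv nuv; pose C := [set w | p w == i].
have c2 w : p w = i -> (#|G w| <= 2)%N.
  move=> pw; have [z [pz nzw]] : exists z, p z = i /\ z != w.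
    by have [uw|] := eqVneq u w; [exists v; rewrite -uw eq_sym|exists u].
  have nz : ~~ adj z w by rewrite -pE pz pw.
  by case: (@multipartite w w z (or_introl erefl) nzw nzw nz nz).
have uC : u \in C by rewrite inE pu.
exists #|C|; split; first by apply/card_gt0P; exists u.
have pC (j : 'I_#|C|) : p (enum_val j) = i by apply/eqP; have := enum_valP j; rewrite inE.
exists (fun j : 'I_#|C| => iota (nonid (enum_val j))); split; [|split; [|split]].
- by move=> j; apply: gen_base; exists (enum_val j), (nonid (enum_val j)); rewrite pC eqxx.
- by move=> j; rewrite -(iotaM hW) nonid_sqr ?(is_hom1 (iotaM hW (v := _))) // c2.
- move=> w; elim=> {w} [_ [w [x [/eqP pw ->]]]||w w' _ IH _ IH'|w _ IH].
  + have [->|->] := order2 x (c2 _ pw); first by rewrite (is_hom1 (iotaM hW (v := w))); exact: gen_one.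
    apply: gen_base; exists (enum_rank_in uC w); rewrite enum_rankK_in // inE pw.
    by rewrite eqxx.
  + exact: gen_one.
  + exact: gen_mul.
  + exact: gen_inv.
move=> H h h2; have [_ [_ U]] := hW.
(* Vertices outside the part are killed; inside, the one non-trivial element goes to the matching
   involution. *)
pose f w (x : G w) := if (p w == i) && (x != 1) then h (enum_rank_in uC w) else 1.
have [w x y|w w' ww' x y|F [FM [Fi _]]] := U H f.
- rewrite /f; case: eqP => //= [pw|_]; last by rewrite mulg1.
  have ni := nonid_neq1 w.
  have [->|->] := order2 x (c2 _ pw); first by rewrite mul1g eqxx /= mul1g.
  have [->|->] := order2 y (c2 _ pw); first by rewrite mulg1 eqxx /= mulg1.
  by rewrite nonid_sqr ?c2 // eqxx ni /= h2.
- rewrite /f; case: eqP => [pw|_] /=; last by rewrite /commute mul1g mulg1.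
  case: (p w' =P i) => [pw'|_] /=; last by rewrite /commute mul1g mulg1.
  by move: ww'; rewrite -[adj w w']negbK -pE pw pw' eqxx.
exists F; split=> [x y _ _|j]; first exact: FM.
by rewrite Fi /f pC eqxx nonid_neq1 /= enum_valK_in.
Qed.
End Multipartite.

(* The theorem: choice of the triple and of the test elements *)
From Stdlib Require Import Reals.

Theorem theorem6p17 (V : finType) (adj : rel V) (hV : 0 < #|V|)
    (hgraph : simple_graph adj)
    (G : V -> finGroupType)
    (hab : forall v (x y : G v), commute x y)
    (hnontriv : forall v, 1 < #|G v|)
    (W : groupType) (iota : forall v, G v -> W)
    (hW : @is_graph_product V adj (fun v => G v : groupType) W iota)
    (hno : ~ exists (l : nat) (p : V -> 'I_l),
             product_decomposition iota p /\
             forall i : 'I_l,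
               let S := sub_gp iota (fun v => p v == i) in
               (exists k, 0 < k /\ iso_Zk S k) \/ finite_abelian_sub S) :
  exists psi : nat -> W -> Rdefinitions.R,
    (forall i, quasimorphism (psi i) /\ homogeneous (psi i) /\ aut_invariant (psi i)) /\
    lin_indep_family psi.
Proof.
have [a [b [d [[stab da db nda ndb] big]]]] : exists a b d,
    [/\ a = b \/ adj a b, d != a, d != b, ~~ adj d a & ~~ adj d b] /\
    (a = b -> 2 < #|G a|).
  case: (excluded_middle_informative (exists a b d,
    [/\ a = b \/ adj a b, d != a, d != b, ~~ adj d a & ~~ adj d b] /\
    (a = b -> 2 < #|G a|))) => // none; case: hno.
  have mult a b d : a = b \/ adj a b -> d != a -> d != b -> ~~ adj d a -> ~~ adj d b ->
      a = b /\ #|G a| <= 2.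
    move=> stab da db nda ndb.
    have [eab|nab] := eqVneq a b; last first.
      by case: none; exists a, b, d; split=> // eab; rewrite eab eqxx in nab.
    split=> //; rewrite leqNgt; apply/negP => big.
    by case: none; exists a, b, d; split.
  have [l [p [psurj pE]]] := multipartite_index hV hgraph mult.
  exists l, p; split; first exact: (multipartite_decomposition hW psurj pE).
  move=> i S; have [v pv] := psurj i.
  case: (boolP [exists u, (p u == i) && (u != v)]) => [/existsP[u /andP[/eqP pu nuv]]|none_u].
    by left; apply: (part_Zk hnontriv hW mult pE pu pv nuv).
  right; apply: (part_singleton hab hW pv) => u pu; apply/eqP.
  by apply: contraNT none_u => nuv; apply/existsP; exists u; rewrite pu eqxx.
have [ab [abM ab_iota]] := abelianisation_exists hab hW.
have [pi [piM pi_iota]] := pi_exists hgraph hab hW nda ndb.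
(* Two distinct non-trivial commuting elements of [A]: both from [G a] if [a = b], otherwise one
   from [G a] and one from [G b]. *)
have [x [u [y [fx fu [nx ny cxy nxy]]]]] : exists (x : G a) u (y : G u),
    [/\ factor a b d a = Some false, factor a b d u = Some false &
        [/\ x != 1, y != 1, commute (iota a x) (iota u y) &
            dfung1 x != dfung1 y :> {dffun forall v, G v}]].
  have fa : factor a b d a = Some false by rewrite /factor !inE eqxx.
  have fb : factor a b d b = Some false by rewrite /factor !inE eqxx orbT.
  have [eab|nab] := eqVneq a b.
    have /card_gt2P[x0 [y0 [z0 [_ [xy yz zx]]]]] := big eab.
    (* Of three distinct elements at least two differ from the identity. *)
    have [x [y [nx ny nxy]]] : exists x y : G a, [/\ x != 1, y != 1 & x != y].
      have [x1|nx] := eqVneq x0 1.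
        by exists y0, z0; rewrite -x1 eq_sym xy zx.
      have [y1|ny] := eqVneq y0 1; last by exists x0, y0.
      by exists z0, x0; rewrite -y1 eq_sym yz y1 nx zx.
    exists x, a, y; do 2 split=> //.
      exact: (commute_hom (iotaM hW (v := a)) (hab _ x y)).
    by apply: contraNneq nxy => /(congr1 (fun k : {dffun forall v, G v} => k a)); rewrite !dfung1_id => ->.
  exists (nonid G a), b, (nonid G b); do 2 split=> //.
  - exact: nonid_neq1.
  - exact: nonid_neq1.
  - by case: stab => [eab|adjab]; [rewrite eab eqxx in nab|exact: (iota_adj hW)].
  apply: contraNneq (nonid_neq1 hnontriv a).
  move/(congr1 (fun k : {dffun forall v, G v} => k a)); rewrite dfung1_id => ->.
  by rewrite dfung1_dflt // eq_sym.
have nsd := nonid_neq1 hnontriv d.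
have [rep repP] := representatives iota ab.
have nd v (t : G v) : t != 1 -> dfung1 t != 1 :> {dffun forall v, G v}.
  by apply: contraNneq => /dfung1_eq1 ->.
have fd : factor a b d d = Some true by rewrite /factor !inE (negPf da) (negPf db) eqxx.
have tors v (t : G v) : iota v t ^+ #[t] = 1.
  by rewrite -(is_homX (iotaM hW (v := v))) expg_order (is_hom1 (iotaM hW (v := v))).
(* The common exponent [E] is the product of the orders of the three test elements. *)
apply: (@independent_family V adj G hab W iota hW ab abM ab_iota a b d stab da db
   pi piM pi_iota x (nonid G d) nx nsd rep repP
   (iota a x) (iota u y) (iota d (nonid G d)) (#[x] * #[y] * #[nonid G d])
   (dfung1 x) (dfung1 y) (dfung1 (nonid G d))) => //.
- by rewrite !muln_gt0 !order_gt0.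
- by apply: (expg_dvdn1 (tors _ x)); rewrite -mulnA dvdn_mulr.
- by apply: (expg_dvdn1 (tors _ y)); rewrite dvdn_mulr // dvdn_mull.
- by apply: (expg_dvdn1 (tors _ _)); rewrite dvdn_mull.
- by rewrite pi_iota /pi_gen fx.
- by rewrite pi_iota /pi_gen fu.
- by rewrite pi_iota /pi_gen fd.
- exact: nd.
- exact: nd.
- exact: nd.
Qed.
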